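(* For every $t,s\in\mathbb R$, $$\langle Q_\sigma 1_{[0,t]},Q_\sigma 1_{[0,s]}\rangle_{\mathbf L_2(\mathbb R,dx)}=\int_{\mathbb R}\frac{e^{iut}-1}{u}\,\frac{e^{-ius}-1}{u}\,d\sigma(u).$$
   Context: $\sigma$ is a Borel probability measure on $\mathbb R$, supported in $[-1/2,1/2]$, and there are distinct numbers $\lambda_0=0,\lambda_1,\lambda_2,\ldots$ in $\pi\mathbb N_0$ such that the functions $e_{\lambda_n}(u)=e^{i\lambda_n u}$, $n\ge0$, form an orthonormal basis of (complex) $\mathbf L_2(d\sigma)$. Fourier transform: $\widehat f(u)=\int_{\mathbb R}e^{iux}f(x)\,dx$. Inner products are linear in the first variable. Let $h_0,h_1,\ldots$ be the Hermite functions (orthonormal basis of $\mathbf L_2(\mathbb R,dx)$), $W:\mathbf L_2(d\sigma)\to\mathbf L_2(\mathbb R,dx)$ the unitary map with $W(e_{\lambda_n})=h_n$, $M_u$ multiplication by $u$ on $\mathbf L_2(d\sigma)$, and $T=WM_uW^*$ (bounded self-adjoint). For a Schwartz function $\psi$ set $Q_\sigma\psi=\widehat\psi(T)h_0=W(\widehat\psi)$. If $g$ is a function (such as $g=1_{[0,t]}$) for which there are Schwartz functions $s_n$ with $\widehat{s_n}\to\widehat g$ uniformly on $\mathbb R$, then $Q_\sigma g$ is defined as $\lim_n Q_\sigma s_n$ in $\mathbf L_2(\mathbb R,dx)$, which does not depend on the choice of the sequence. For $t<0$, $1_{[0,t]}$ means $-1_{[t,0]}$. The quotients $(e^{iut}-1)/u$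 and $(e^{-ius}-1)/u$ are extended continuously to $u=0$. *)

(* Defs.v *)
From mathcomp Require Import all_boot all_order all_algebra.
From mathcomp Require Import complex.
From mathcomp Require Import all_classical all_reals all_analysis.

Set Implicit Arguments.
Unset Strict Implicit.
Unset Printing Implicit Defensive.

Import Order.TTheory GRing.Theory Num.Theory.
Import numFieldNormedType.Exports.

Local Open Scope classical_set_scope.
Local Open Scope ring_scope.
Local Open Scope complex_scope.

(* Elements of the complex space L2(mu), for a Borel measure mu on R, are
   handled through representatives: Borel functions R -> R[i] in the predicate
   L2 mu, two of them being identified when they agree mu-almost everywhere.
   Operators act on representatives.  Where an element of L2 is characterized
   only up to almost-everywhere equality, one representative is picked with
   xget (whose default value 0 is returned if there is none). *)

Definition leb (R : realType) : {measure set (measurableTypeR R) -> \bar R} :=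
  @lebesgue_measure R.

(* Meaningful when the real and imaginary parts of f are integrable. *)
Definition Cintegral (R : realType)
    (mu : {measure set (measurableTypeR R) -> \bar R}) (f : R -> R[i]) : R[i] :=
  (\int[mu]_(x in setT) complex.Re (f x)) +i* (\int[mu]_(x in setT) complex.Im (f x)).

Definition L2 (R : realType)
    (mu : {measure set (measurableTypeR R) -> \bar R}) (f : R -> R[i]) : Prop :=
  (fun x => complex.Re (f x)) \in Lfun mu 2%:E /\ (fun x => complex.Im (f x)) \in Lfun mu 2%:E.

Definition inner (R : realType)
    (mu : {measure set (measurableTypeR R) -> \bar R}) (f g : R -> R[i]) : R[i] :=
  Cintegral mu (fun x => f x * (g x)^*).

Definition L2norm (R : realType)
    (mu : {measure set (measurableTypeR R) -> \bar R}) (f : R -> R[i]) : R :=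
  Num.sqrt (complex.Re (inner mu f f)).

Definition L2cvg (R : realType)
    (mu : {measure set (measurableTypeR R) -> \bar R})
    (F : nat -> R -> R[i]) (f : R -> R[i]) : Prop :=
  (fun n => L2norm mu (fun x => F n x - f x)) @ \oo --> (0 : R).

Definition orthonormal_basis (R : realType)
    (mu : {measure set (measurableTypeR R) -> \bar R})
    (e : nat -> R -> R[i]) : Prop :=
  [/\ forall n, L2 mu (e n),
      forall m n, inner mu (e m) (e n) = (m == n)%:R &
      forall f, L2 mu f -> forall eps : R, 0 < eps ->
        exists (N : nat) (c : nat -> R[i]),
          L2norm mu (fun x => f x - \sum_(k < N) c k * e k x) < eps].

Definition unitary (R : realType)
    (mu nu : {measure set (measurableTypeR R) -> \bar R})
    (W : (R -> R[i]) -> R -> R[i]) : Prop :=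
  [/\ forall f, L2 mu f -> L2 nu (W f),
      forall f g, L2 mu f -> L2 mu g ->
        f = g %[ae mu] -> W f = W g %[ae nu],
      forall (a : R[i]) f g, L2 mu f -> L2 mu g ->
        W (fun u => a * f u + g u) = (fun x => a * W f x + W g x) %[ae nu],
      forall f g, L2 mu f -> L2 mu g -> inner nu (W f) (W g) = inner mu f g &
      forall F, L2 nu F -> exists2 f, L2 mu f & W f = F %[ae nu]].

Definition adjoint (R : realType)
    (mu nu : {measure set (measurableTypeR R) -> \bar R})
    (W : (R -> R[i]) -> R -> R[i]) (F : R -> R[i]) : R -> R[i] :=
  xget (fun=> 0) [set f | L2 mu f /\
    forall g, L2 mu g -> inner nu (W g) F = inner mu g f].

Definition mulu (R : realType) (f : R -> R[i]) (u : R) : R[i] := u%:C * f u.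

Definition opT (R : realType)
    (sigma : {measure set (measurableTypeR R) -> \bar R})
    (W : (R -> R[i]) -> R -> R[i]) (F : R -> R[i]) : R -> R[i] :=
  W (mulu (adjoint sigma (leb R) W F)).

Definition poly_op (R : realType) (p : {poly R[i]})
    (T : (R -> R[i]) -> R -> R[i]) (F : R -> R[i]) (x : R) : R[i] :=
  \sum_(k < size p) p`_k * iter k T F x.

Definition unif_cvg_on (R : realType) (D : set R)
    (f_ : nat -> R -> R[i]) (f : R -> R[i]) : Prop :=
  forall eps : R, 0 < eps ->
    \forall n \near \oo, forall u, D u -> complex.Re `|f_ n u - f u| < eps.

(* Continuous functional calculus phi(T) F for a bounded self-adjoint operator
   T of L2(mu) whose spectrum lies in [a, b]: the limit of p_n(T) F for any
   polynomials p_n converging to phi uniformly on [a, b]. *)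
Definition fun_calc (R : realType)
    (mu : {measure set (measurableTypeR R) -> \bar R}) (a b : R)
    (phi : R -> R[i]) (T : (R -> R[i]) -> R -> R[i]) (F : R -> R[i]) :
    R -> R[i] :=
  xget (fun=> 0) [set G | L2 mu G /\
    exists p : nat -> {poly R[i]},
      unif_cvg_on `[a, b] (fun n u => (p n).[u%:C]) phi /\
      L2cvg mu (fun n => poly_op (p n) T F) G].

Definition expi (R : realType) (x : R) : R[i] := cos x +i* sin x.

Definition hermite_poly (R : realType) (n : nat) (x : R) : R :=
  (-1) ^+ n * expR (x ^+ 2) * derive1n n (fun y : R => expR (- y ^+ 2)) x.

Definition hermite (R : realType) (n : nat) (x : R) : R[i] :=
  (hermite_poly n x * expR (- x ^+ 2 / 2) /
     Num.sqrt (2 ^+ n * n`!%:R * Num.sqrt (@pi R)))%:C.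

Definition schwartzR (R : realType) (f : R -> R) : Prop :=
  (forall n x, derivable (derive1n n f) x 1) /\
  (forall k m : nat, exists M : R, forall x, `|x ^+ k * derive1n m f x| <= M).

Definition schwartz (R : realType) (f : R -> R[i]) : Prop :=
  schwartzR (fun x => complex.Re (f x)) /\ schwartzR (fun x => complex.Im (f x)).

Definition fourier (R : realType) (f : R -> R[i]) (u : R) : R[i] :=
  Cintegral (leb R) (fun x => expi (u * x) * f x).

(* The spectrum of opT sigma W is the support of sigma, which is assumed to be
   contained in [-1/2, 1/2]. *)
Definition Qschwartz (R : realType)
    (sigma : {measure set (measurableTypeR R) -> \bar R})
    (W : (R -> R[i]) -> R -> R[i]) (psi : R -> R[i]) : R -> R[i] :=
  fun_calc (leb R) (- 2^-1) 2^-1 (fourier psi) (opT sigma W) (@hermite R 0%N).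

Definition Qsigma (R : realType)
    (sigma : {measure set (measurableTypeR R) -> \bar R})
    (W : (R -> R[i]) -> R -> R[i]) (g : R -> R[i]) : R -> R[i] :=
  xget (fun=> 0) [set G | L2 (leb R) G /\
    exists s_ : nat -> R -> R[i],
      [/\ forall n, schwartz (s_ n),
          unif_cvg_on setT (fun n => fourier (s_ n)) (fourier g) &
          L2cvg (leb R) (fun n => Qschwartz sigma W (s_ n)) G]].

Definition oriented_indic (R : realType) (t x : R) : R[i] :=
  (if 0 <= t then \1_(`[0, t]) x else - \1_(`[t, 0]) x)%:C.

(* The continuous extension of u |-> (exp (i u t) - 1) / u. *)
Definition expq (R : realType) (t u : R) : R[i] :=
  if u == 0 then t *i else (expi (u * t) - 1) / u%:C.

(* Main.v *)
Require Import Defs.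
From mathcomp Require Import all_boot all_order all_algebra.
From mathcomp Require Import complex.
From mathcomp Require Import all_classical all_reals all_analysis.
From mathcomp Require Import measurable_realfun.
From mathcomp Require Import ring lra.

(** The map W turns multiplication by u into T.  Since h_0 = W(1), the
    exponential of frequency 0 being 1, a polynomial in T applied to h_0 is W of
    the same polynomial in u.  The statement is then an instance of W preserving
    inner products, once it is known that Q_sigma 1_[0,t] = W(f_t) almost
    everywhere, where f_t is the Fourier transform of 1_[0,t].  Indeed
    f_t(u) = - i (exp(iut) - 1) / u (fourier_oriented_indic) and the two factors
    - i cancel in f_t * conj(f_s).

    Two limits separate Q_sigma 1_[0,t] from polynomials in T, and both are
    handled by L2cvg_W: since sigma lives on [-1/2, 1/2], uniform convergence
    there implies convergence in L2(sigma), which the isometry W carries to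
    L2(dx); a limit in L2(dx) is then W of the uniform limit, and nothing else.
    As the limits are given by a choice among all admissible approximating
    sequences, it has to be shown that at least one sequence exists and that
    every sequence leads to the same class.

    - For a Schwartz function psi the Fourier transform is Lipschitz, because
      x psi(x) is integrable, and a Lipschitz function is a uniform limit of
      polynomials on [-1/2, 1/2] (Bernstein polynomials, lipschitz_unif_cvg).
      Hence Q_sigma psi = W(fourier psi) (Qschwartz_W).

    - For the indicator, the difference of two logistic functions
      S(nx) - S(n(x - t)) is a Schwartz function which tends to the oriented
      indicator of [0, t] in L1 (smooth_step_schwartz, smooth_step_L1).  The
      Fourier transforms then converge uniformly, since they are bounded by
      L1 norms (fourier_dist). *)

Set Implicit Arguments.
Unset Strict Implicit.
Unset Printing Implicit Defensive.

Import Order.TTheory GRing.Theory Num.Theory.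
Import numFieldNormedType.Exports.

Local Open Scope classical_set_scope.
Local Open Scope ring_scope.

(** * Square-integrable complex functions *)

Local Notation Re := complex.Re.
Local Notation Im := complex.Im.

Lemma ReB (R : realType) (x y : R[i]) : Re (x - y) = Re x - Re y.
Proof. by case: x y => [a b] [c d]. Qed.

Lemma ImB (R : realType) (x y : R[i]) : Im (x - y) = Im x - Im y.
Proof. by case: x y => [a b] [c d]. Qed.

Lemma ReD (R : realType) (x y : R[i]) : Re (x + y) = Re x + Re y.
Proof. by case: x y => [a b] [c d]. Qed.

Lemma ImD (R : realType) (x y : R[i]) : Im (x + y) = Im x + Im y.
Proof. by case: x y => [a b] [c d]. Qed.

Lemma ReM (R : realType) (x y : R[i]) : Re (x * y) = Re x * Re y - Im x * Im y.
Proof. by case: x y => [a b] [c d]. Qed.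

Lemma ImM (R : realType) (x y : R[i]) : Im (x * y) = Re x * Im y + Im x * Re y.
Proof. by case: x y => [a b] [c d]. Qed.

Lemma ReJ (R : realType) (x : R[i]) : Re (x^*)%C = Re x.
Proof. by case: x. Qed.

Lemma ImJ (R : realType) (x : R[i]) : Im (x^*)%C = - Im x.
Proof. by case: x. Qed.

Lemma complex_norm_le (R : realType) (z : R[i]) : Re `|z| <= `|Re z| + `|Im z|.
Proof.
rewrite normc_def /= -[leRHS]ger0_norm ?addr_ge0// -sqrtr_sqr ler_sqrt ?sqr_ge0//.
rewrite -(real_normK (num_real (Re z))) -(real_normK (num_real (Im z))).
by rewrite sqrrD lerD2r lerDl mulrn_wge0// mulr_ge0.
Qed.

Lemma Re_Im_le_norm (R : realType) (z : R[i]) (e : R) :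
  Re `|z| < e -> `|Re z| <= e /\ `|Im z| <= e.
Proof.
rewrite normc_def /= => h; split; apply: le_trans (ltW h); rewrite -sqrtr_sqr.
- by rewrite ler_sqrt ?addr_ge0 ?sqr_ge0// lerDl sqr_ge0.
- by rewrite ler_sqrt ?addr_ge0 ?sqr_ge0// lerDr sqr_ge0.
Qed.

Lemma integrable_addR d (T : measurableType d) (R : realType)
    (mu : {measure set T -> \bar R}) (f g : T -> R) :
  mu.-integrable setT (EFin \o f) -> mu.-integrable setT (EFin \o g) ->
  mu.-integrable setT (EFin \o (fun x => f x + g x)).
Proof. by move=> i j; have := integrableD measurableT i j. Qed.

Lemma integrable_subR d (T : measurableType d) (R : realType)
    (mu : {measure set T -> \bar R}) (f g : T -> R) :
  mu.-integrable setT (EFin \o f) -> mu.-integrable setT (EFin \o g) ->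
  mu.-integrable setT (EFin \o (fun x => f x - g x)).
Proof. by move=> i j; have := integrableB measurableT i j. Qed.

Lemma integrable_mulR d (T : measurableType d) (R : realType)
    (mu : {measure set T -> \bar R}) (c : R) (f : T -> R) :
  mu.-integrable setT (EFin \o f) ->
  mu.-integrable setT (EFin \o (fun x => c * f x)).
Proof. by move=> i; have := integrableZl measurableT c i. Qed.

Lemma Lfun2P d (T : measurableType d) (R : realType)
    (mu : {measure set T -> \bar R}) (f : T -> R) :
  f \in Lfun mu 2%:E <->
  measurable_fun setT f /\ mu.-integrable setT (EFin \o (fun x => f x ^+ 2)).
Proof.
split => [f2|[mf intf]].
  split; last exact: Lfun2_integrable_sqr.
  by move: f2 => /andP[]; rewrite inE.
rewrite inE; apply/andP; split; first by rewrite inE.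
rewrite inE/= /finite_norm unlock poweR_lty//.
move/integrableP : intf => [_]; apply: le_lt_trans.
rewrite le_eqVlt; apply/orP; left; apply/eqP; apply: eq_integral => x _ /=.
by rewrite normrX powR_mulrn.
Qed.

Lemma Lfun2_0 d (T : measurableType d) (R : realType)
    (mu : {measure set T -> \bar R}) : (fun=> 0 : R) \in Lfun mu 2%:E.
Proof.
apply/Lfun2P; split => //=.
by under eq_fun do rewrite expr0n/=; exact: integrable0.
Qed.

Lemma Lfun2D d (T : measurableType d) (R : realType)
    (mu : {measure set T -> \bar R}) (f g : T -> R) :
  f \in Lfun mu 2%:E -> g \in Lfun mu 2%:E -> (fun x => f x + g x) \in Lfun mu 2%:E.
Proof.
have h : (1 <= 2%:E :> \bar R)%E by rewrite lee_fin ler1n.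
by move=> f2 g2; have [_ /(_ f g f2 g2)] := Lfun_addr_closed mu h.
Qed.

Lemma Lfun2Z d (T : measurableType d) (R : realType)
    (mu : {measure set T -> \bar R}) (a : R) (f : T -> R) :
  f \in Lfun mu 2%:E -> (fun x => a * f x) \in Lfun mu 2%:E.
Proof.
move=> f2; have h : 1 <= 2 :> R by rewrite ler1n.
have -> : (fun x => a * f x) = a \o* f by apply/funext => x; rewrite mulrC.
exact: Lfun_scale.
Qed.

Lemma Lfun2M_integrable d (T : measurableType d) (R : realType)
    (mu : {measure set T -> \bar R}) (f g : T -> R) :
  f \in Lfun mu 2%:E -> g \in Lfun mu 2%:E ->
  mu.-integrable setT (EFin \o (fun x => f x * g x)).
Proof. by move=> f2 g2; have /Lfun1_integrable := Lfun2_mul_Lfun1 f2 g2. Qed.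

Lemma aeS (R : realType) (mu : {measure set (measurableTypeR R) -> \bar R})
    (P Q : R -> Prop) : (forall x, P x -> Q x) ->
  (\forall x \ae mu, P x) -> \forall x \ae mu, Q x.
Proof. exact: (@filterS _ _ (ae_filter_ringOfSetsType mu)). Qed.

Lemma aeS2 (R : realType) (mu : {measure set (measurableTypeR R) -> \bar R})
    (P Q S : R -> Prop) : (forall x, P x -> Q x -> S x) ->
  (\forall x \ae mu, P x) -> (\forall x \ae mu, Q x) -> \forall x \ae mu, S x.
Proof. exact: (@filterS2 _ _ (ae_filter_ringOfSetsType mu)). Qed.

Lemma Lfun2_ae_le (R : realType)
    (mu : {measure set (measurableTypeR R) -> \bar R})
    (f g : R -> R) : measurable_fun [set: measurableTypeR R] g ->
  f \in Lfun mu 2%:E -> (\forall x \ae mu, g x ^+ 2 <= f x ^+ 2) ->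
  g \in Lfun mu 2%:E.
Proof.
move=> mg /Lfun2P[mf /integrableP[mf2 if2]] gf; apply/Lfun2P; split=> //.
apply/integrableP; split.
  by apply/measurable_EFinP; exact: measurable_funX.
apply: le_lt_trans if2; apply: ae_ge0_le_integral => //.
- by apply: measurableT_comp => //; apply/measurable_EFinP; exact: measurable_funX.
- exact: measurableT_comp.
- by apply: aeS gf => x gfx _; rewrite lee_fin !ger0_norm ?sqr_ge0.
Qed.

Section complex_L2.
Context (R : realType) (mu : {measure set (measurableTypeR R) -> \bar R}).
Implicit Types (f g h : R -> R[i]) (a : R[i]).

Definition cmeasurable f :=
  measurable_fun [set: measurableTypeR R] (fun x => Re (f x)) /\
  measurable_fun [set: measurableTypeR R] (fun x => Im (f x)).

Lemma L2_cmeasurable f : L2 mu f -> cmeasurable f.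
Proof. by move=> [/Lfun2P[? _] /Lfun2P[? _]]. Qed.

Lemma cmeasurableM f g : cmeasurable f -> cmeasurable g ->
  cmeasurable (fun x => f x * g x).
Proof.
move=> [f1 f2] [g1 g2]; split.
- under eq_fun do rewrite ReM.
  by apply: measurable_funB; exact: measurable_funM.
- under eq_fun do rewrite ImM.
  by apply: measurable_funD; exact: measurable_funM.
Qed.

Lemma cmeasurableJ f : cmeasurable f -> cmeasurable (fun x => (f x)^*%C).
Proof.
move=> [f1 f2]; split.
- by under eq_fun do rewrite ReJ.
- by under eq_fun do rewrite ImJ; exact: measurable_funN.
Qed.

Lemma Cintegral_ae f g : cmeasurable f -> cmeasurable g ->
  f = g %[ae mu] -> Cintegral mu f = Cintegral mu g.
Proof.
move=> [f1 f2] [g1 g2] fg; rewrite /Cintegral /Rintegral; congr Complex; congr fine.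
- apply: ae_eq_integral => //; [exact/measurable_EFinP..|].
  by apply: aeS fg => x fgx _; rewrite fgx.
- apply: ae_eq_integral => //; [exact/measurable_EFinP..|].
  by apply: aeS fg => x fgx _; rewrite fgx.
Qed.

Lemma inner_ae f f' g g' : L2 mu f -> L2 mu f' -> L2 mu g -> L2 mu g' ->
  f = f' %[ae mu] -> g = g' %[ae mu] -> inner mu f g = inner mu f' g'.
Proof.
move=> /L2_cmeasurable mf /L2_cmeasurable mf' /L2_cmeasurable mg
  /L2_cmeasurable mg' ff' gg'.
apply: Cintegral_ae; [exact/cmeasurableM/cmeasurableJ..|].
by apply: aeS2 ff' gg' => x + + _ => -> // ->.
Qed.

Lemma L2D f g : L2 mu f -> L2 mu g -> L2 mu (fun x => f x + g x).
Proof.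
move=> [f1 f2] [g1 g2]; split.
- by under eq_fun do rewrite ReD; exact: Lfun2D.
- by under eq_fun do rewrite ImD; exact: Lfun2D.
Qed.

Lemma L2Z a f : L2 mu f -> L2 mu (fun x => a * f x).
Proof.
move=> [f1 f2]; split.
- under eq_fun do rewrite ReM -mulNr; by apply: Lfun2D; exact: Lfun2Z.
- by under eq_fun do rewrite ImM; apply: Lfun2D; exact: Lfun2Z.
Qed.

Lemma L2B f g : L2 mu f -> L2 mu g -> L2 mu (fun x => f x - g x).
Proof.
move=> f2 /(L2Z (-1)) g2; have := L2D f2 g2.
by congr (L2 mu _); apply/funext => x; rewrite mulN1r.
Qed.

(** For the uniqueness of the vector representing a given functional. *)
Lemma innerBr f g h : L2 mu f -> L2 mu g -> L2 mu h ->
  inner mu h (fun x => f x - g x) = inner mu h f - inner mu h g.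
Proof.
move=> [f1 f2] [g1 g2] [h1 h2]; rewrite /inner /Cintegral.
have int := Lfun2M_integrable.
apply/eqP; rewrite eq_complex; apply/andP; split; apply/eqP.
- rewrite ReB /= -RintegralB//; last 2 first.
  + under eq_fun do rewrite ReM ReJ ImJ mulrN opprK.
    by apply: integrable_addR; exact: int.
  + under eq_fun do rewrite ReM ReJ ImJ mulrN opprK.
    by apply: integrable_addR; exact: int.
  by apply: eq_Rintegral => x _; rewrite -ReB -mulrBr -raddfB.
- rewrite ImB /= -RintegralB//; last 2 first.
  + under eq_fun do rewrite ImM ReJ ImJ mulrN addrC.
    by apply: integrable_subR; exact: int.
  + under eq_fun do rewrite ImM ReJ ImJ mulrN addrC.
    by apply: integrable_subR; exact: int.
  by apply: eq_Rintegral => x _; rewrite -ImB -mulrBr -raddfB.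
Qed.

Definition sqnorm f : R := Re (inner mu f f).

Lemma sqnormE f : sqnorm f = \int[mu]_x (Re (f x) ^+ 2 + Im (f x) ^+ 2).
Proof.
by apply: eq_Rintegral => x _; rewrite ReM ReJ ImJ mulrN opprK !expr2.
Qed.

Lemma sqnorm_ge0 f : 0 <= sqnorm f.
Proof. by rewrite sqnormE; apply: Rintegral_ge0 => x _; rewrite addr_ge0 ?sqr_ge0. Qed.

Lemma L2_integrable_sq f : L2 mu f ->
  mu.-integrable setT (EFin \o (fun x => Re (f x) ^+ 2 + Im (f x) ^+ 2)).
Proof.
by move=> [/Lfun2P[_ i1] /Lfun2P[_ i2]]; exact: integrable_addR.
Qed.

Lemma sqnorm_ae f g : L2 mu f -> L2 mu g -> f = g %[ae mu] -> sqnorm f = sqnorm g.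
Proof. by move=> f2 g2 fg; rewrite /sqnorm (inner_ae f2 g2 f2 g2). Qed.

(** This follows pointwise from the parallelogram law, and replaces the triangle
    inequality of the norm in the comparison of limits. *)
Lemma sqnormD_le f g : L2 mu f -> L2 mu g ->
  sqnorm (fun x => f x + g x) <= 2 * sqnorm f + 2 * sqnorm g.
Proof.
move=> f2 g2; rewrite !sqnormE.
rewrite -!RintegralZl//; [|exact: L2_integrable_sq..].
have i c h : L2 mu h -> mu.-integrable setT
    (EFin \o (fun x => c * (Re (h x) ^+ 2 + Im (h x) ^+ 2))).
  by move=> /L2_integrable_sq ih; exact: integrable_mulR.
rewrite -RintegralD//; [|exact: i..].
apply: le_Rintegral => //.
- exact/L2_integrable_sq/L2D.
- by apply: integrable_addR; exact: i.
move=> x _; rewrite ReD ImD.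
have := sqr_ge0 (Re (f x) - Re (g x)); have := sqr_ge0 (Im (f x) - Im (g x)).
by nra.
Qed.

Lemma sqnorm_eq0 f : L2 mu f -> sqnorm f = 0 -> f = cst 0 %[ae mu].
Proof.
move=> f2; rewrite sqnormE => f0.
have i := L2_integrable_sq f2.
have : (\int[mu]_x `|(Re (f x) ^+ 2 + Im (f x) ^+ 2)%:E| = 0)%E.
  under eq_integral do rewrite gee0_abs ?lee_fin ?addr_ge0 ?sqr_ge0//.
  by rewrite -(fineK (integrable_fin_num measurableT i)); congr EFin.
move=> /ae_eq_integral_abs => /(_ measurableT (measurable_int _ i)).
apply: aeS => x /[apply] -[] /eqP; rewrite paddr_eq0 ?sqr_ge0//.
rewrite !sqrf_eq0 => /andP[/eqP r /eqP s].
by move: r s; case: (f x) => a b /= -> ->.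
Qed.

Lemma L2cvgP (F : nat -> R -> R[i]) f : L2cvg mu F f <->
  forall e : R, 0 < e -> \forall n \near \oo, sqnorm (fun x => F n x - f x) < e.
Proof.
split => [Ff e e0|Ff].
  have se : 0 < Num.sqrt e by rewrite sqrtr_gt0.
  move/cvgrPdist_lt : Ff => /(_ _ se); apply: filterS => n.
  rewrite sub0r normrN ger0_norm ?sqrtr_ge0// ltr_sqrt//.
apply/cvgrPdist_lt => e e0.
have e20 : 0 < e ^+ 2 by rewrite exprn_gt0.
have := Ff _ e20; apply: filterS => n.
rewrite sub0r normrN ger0_norm ?sqrtr_ge0// => h.
by rewrite -(ger0_norm (ltW e0)) -sqrtr_sqr ltr_sqrt.
Qed.

End complex_L2.

(** * Functional calculus of the transported multiplication operator *)

Section functional_calculus.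
Context (R : realType) (sigma : probability (measurableTypeR R) R)
  (W : (R -> R[i]) -> R -> R[i]).
Hypothesis sigma_supp : sigma (~` `[- 2^-1, 2^-1]) = 0%E.
Hypothesis W_unitary : unitary sigma (leb R) W.

Lemma supp_ae (P : R -> Prop) :
  (forall u, `[- 2^-1, 2^-1]%classic u -> P u) -> \forall u \ae sigma, P u.
Proof.
move=> DP; exists (~` `[- 2^-1, 2^-1]); split => //.
- by apply: measurableC; exact: measurable_itv.
- by apply: subsetC.
Qed.

(** A bound on the support holds almost everywhere, and sigma has finite mass. *)
Lemma L2_bounded (f : R -> R[i]) (M : R) : cmeasurable f ->
  (forall u, `[- 2^-1, 2^-1]%classic u -> `|Re (f u)| <= M /\ `|Im (f u)| <= M) ->
  L2 sigma f.
Proof.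
move=> [mr mi] fM; split; apply: (@Lfun2_ae_le _ _ (cst M)) => //.
- exact: Lfun_cst.
- apply: supp_ae => u /fM[h _] /=.
  by rewrite -[leLHS]real_normK ?num_real// ler_pXn2r ?nnegrE// (le_trans _ h).
- exact: Lfun_cst.
- apply: supp_ae => u /fM[_ h] /=.
  by rewrite -[leLHS]real_normK ?num_real// ler_pXn2r ?nnegrE// (le_trans _ h).
Qed.

Lemma sqnorm_bounded (f : R -> R[i]) (M : R) : L2 sigma f ->
  (forall u, `[- 2^-1, 2^-1]%classic u -> `|Re (f u)| <= M /\ `|Im (f u)| <= M) ->
  sqnorm sigma f <= 2 * M ^+ 2.
Proof.
move=> f2 fM; rewrite sqnormE.
have i := L2_integrable_sq f2.
rewrite -lee_fin fineK; last exact: (integrable_fin_num measurableT i).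
have -> : (2 * M ^+ 2)%:E = (\int[sigma]_x (cst (2 * M ^+ 2)%:E x))%E.
  rewrite integral_cst// [X in (_ * X)%E](_ : _ = 1%E) ?mule1//.
  exact: probability_setT.
apply: ae_ge0_le_integral => //.
- by move=> x _; rewrite lee_fin addr_ge0 ?sqr_ge0.
- exact: measurable_int i.
- by move=> x _; rewrite lee_fin mulr_ge0 ?sqr_ge0.
apply: supp_ae => u /fM[h1 h2] _ /=; rewrite lee_fin mulr2n mulrDl mul1r.
have sqle (x : R) : `|x| <= M -> x ^+ 2 <= M ^+ 2.
  move=> h; rewrite -[leLHS]real_normK ?num_real// ler_pXn2r ?nnegrE//.
  exact: le_trans h.
by apply: lerD; exact: sqle.
Qed.

(** Multiplication by u is bounded on L2(sigma) because |u| <= 1/2 on the support. *)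
Lemma L2_mulu (f : R -> R[i]) : L2 sigma f -> L2 sigma (mulu f).
Proof.
have sqle (u x : R) : `[- 2^-1, 2^-1]%classic u -> (u * x) ^+ 2 <= x ^+ 2.
  rewrite /= in_itv/= => /andP[u1 u2].
  have : u ^+ 2 <= 1 by nra.
  rewrite exprMn; have := sqr_ge0 x; have := sqr_ge0 u; by nra.
move=> f2; have [mr mi] := L2_cmeasurable f2; case: f2 => fr fi; split.
- rewrite /mulu; under eq_fun do rewrite ReM /= mul0r subr0.
  apply: Lfun2_ae_le fr _; first exact: measurable_funM.
  by apply: supp_ae => u /sqle.
- rewrite /mulu; under eq_fun do rewrite ImM /= mul0r addr0.
  apply: Lfun2_ae_le fi _; first exact: measurable_funM.
  by apply: supp_ae => u /sqle.
Qed.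

Lemma W_L2 f : L2 sigma f -> L2 (leb R) (W f).
Proof. by case: W_unitary => h *; exact: h. Qed.

Lemma W_ae f g : L2 sigma f -> L2 sigma g ->
  f = g %[ae sigma] -> W f = W g %[ae leb R].
Proof. by case: W_unitary => _ h _ _ _; exact: h. Qed.

Lemma W_linear (a : R[i]) f g : L2 sigma f -> L2 sigma g ->
  W (fun u => a * f u + g u) = (fun x => a * W f x + W g x) %[ae leb R].
Proof. by case: W_unitary => _ _ h _ _; exact: h. Qed.

Lemma W_inner f g : L2 sigma f -> L2 sigma g ->
  inner (leb R) (W f) (W g) = inner sigma f g.
Proof. by case: W_unitary => _ _ _ h _; exact: h. Qed.

Lemma W_isometry f g : L2 sigma f -> L2 sigma g ->
  sqnorm (leb R) (fun x => W f x - W g x) = sqnorm sigma (fun u => f u - g u).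
Proof.
move=> f2 g2; rewrite {2}/sqnorm -W_inner; [|exact: L2B..].
apply: sqnorm_ae; [exact: L2B (W_L2 f2) (W_L2 g2)|exact/W_L2/L2B|].
have -> : (fun u => f u - g u) = (fun u => -1 * g u + f u).
  by apply/funext => u; rewrite mulN1r addrC.
apply: aeS (W_linear (-1) g2 f2) => x /[apply] ->.
by rewrite mulN1r addrC.
Qed.

(** W f is represented by f itself, as W preserves inner products, and the
    representing vector is unique: testing two candidates against their
    difference shows that this difference has norm zero. *)
Lemma adjoint_W (F f : R -> R[i]) : L2 (leb R) F -> L2 sigma f ->
  F = W f %[ae leb R] ->
  L2 sigma (adjoint sigma (leb R) W F) /\
  adjoint sigma (leb R) W F = f %[ae sigma].
Proof.
move=> F2 f2 FWf; rewrite /adjoint; set A := (X in xget _ X).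
have Af : A f.
  split => // g g2; rewrite -W_inner//.
  by apply: (inner_ae (W_L2 g2) (W_L2 g2) F2 (W_L2 f2)) FWf; exact: aeW.
have [f'2 f'A] : A (xget (fun=> 0) A) by apply: xgetPex; exists f.
split=> //; move: f'2 f'A; set f' := xget _ _ => f'2 f'A.
have d2 := L2B f'2 f2.
have d0 : sqnorm sigma (fun u => f' u - f u) = 0.
  rewrite /sqnorm innerBr// -f'A//.
  by case: Af => _ /(_ _ d2) ->; rewrite subrr.
apply: aeS (sqnorm_eq0 d2 d0) => u /[apply] /= /eqP.
by rewrite subr_eq0 => /eqP.
Qed.

Lemma opT_W (F f : R -> R[i]) : L2 (leb R) F -> L2 sigma f ->
  F = W f %[ae leb R] ->
  L2 (leb R) (opT sigma W F) /\ opT sigma W F = W (mulu f) %[ae leb R].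
Proof.
move=> F2 f2 FWf; have [a2 af] := adjoint_W F2 f2 FWf.
rewrite /opT; split; first by apply: W_L2; exact: L2_mulu.
apply: W_ae; [exact: L2_mulu|exact: L2_mulu|].
by apply: aeS af => u /[apply]; rewrite /mulu => ->.
Qed.

Lemma L2_cst (c : R[i]) : L2 sigma (cst c).
Proof. by split; exact: Lfun_cst. Qed.

Hypothesis W1 : W (cst 1) = hermite 0 %[ae leb R].
Hypothesis h2 : L2 (leb R) (@hermite R 0).

Local Notation T := (opT sigma W).
Local Notation h0 := (@hermite R 0).

Lemma iter_opT_W k : [/\ L2 sigma (fun u => u%:C%C ^+ k),
  L2 (leb R) (iter k T h0) &
  iter k T h0 = W (fun u => u%:C%C ^+ k) %[ae leb R]].
Proof.
elim: k => [|k [u2 T2 TW]].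
  split; [exact: L2_cst|exact: h2|].
  by apply: aeS W1 => x h _; exact: esym (h I).
have -> : (fun u : R => u%:C%C ^+ k.+1) = mulu (fun u => u%:C%C ^+ k).
  by apply/funext => u; rewrite exprS.
have [? ?] := opT_W T2 u2 TW.
by split => //; exact: L2_mulu.
Qed.

Lemma sum_iter_opT_W n (c : nat -> R[i]) :
  [/\ L2 sigma (fun u => \sum_(k < n) c k * u%:C%C ^+ k),
  L2 (leb R) (fun x => \sum_(k < n) c k * iter k T h0 x) &
  (fun x => \sum_(k < n) c k * iter k T h0 x) =
    W (fun u => \sum_(k < n) c k * u%:C%C ^+ k) %[ae leb R]].
Proof.
elim: n => [|n [u2 T2 TW]].
  have L20 mu : L2 mu (fun _ : R => 0 : R[i]).
    by split; exact: Lfun2_0.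
  (* W 0 = 0 because it has norm zero. *)
  have s0 : sqnorm (leb R) (W (fun=> 0)) = 0.
    rewrite /sqnorm W_inner; [|exact: L20..].
    rewrite -/(sqnorm _ _) sqnormE.
    by under eq_Rintegral do rewrite /= expr0n/= addr0; rewrite Rintegral_cst// mul0r.
  have -> : (fun u : R => \sum_(k < 0) c k * u%:C%C ^+ k) = (fun=> 0).
    by apply/funext => u; rewrite big_ord0.
  split.
  - exact: L20.
  - by under eq_fun do rewrite big_ord0; exact: L20.
  - apply: aeS (sqnorm_eq0 (W_L2 (L20 _)) s0) => x /[apply] ->.
    by rewrite big_ord0.
have [un2 Tn2 TnW] := iter_opT_W n.
have -> : (fun u : R => \sum_(k < n.+1) c k * u%:C%C ^+ k) =
    (fun u => c n * u%:C%C ^+ n + \sum_(k < n) c k * u%:C%C ^+ k).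
  by apply/funext => u; rewrite big_ord_recr addrC.
have -> : (fun x : R => \sum_(k < n.+1) c k * iter k T h0 x) =
    (fun x => c n * iter n T h0 x + \sum_(k < n) c k * iter k T h0 x).
  by apply/funext => x; rewrite big_ord_recr addrC.
split; [exact: L2D (L2Z _ un2) u2|exact: L2D (L2Z _ Tn2) T2|].
have aT : \forall x \ae leb R, iter n T h0 x = W (fun u => u%:C%C ^+ n) x /\
    \sum_(k < n) c k * iter k T h0 x = W (fun u => \sum_(k < n) c k * u%:C%C ^+ k) x.
  by apply: aeS2 TnW TW => x h k; split; [exact: h|exact: k].
apply: aeS2 aT (W_linear (c n) un2 u2) => x [hx kx] /(_ I) /= -> _.
by rewrite -hx -kx big_ord_recr addrC.
Qed.

Lemma poly_op_W (p : {poly R[i]}) : [/\ L2 sigma (fun u => p.[u%:C%C]),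
  L2 (leb R) (poly_op p T h0) &
  poly_op p T h0 = W (fun u => p.[u%:C%C]) %[ae leb R]].
Proof.
have -> : (fun u : R => p.[u%:C%C]) =
    (fun u => \sum_(k < size p) p`_k * u%:C%C ^+ k).
  by apply/funext => u; rewrite horner_coef.
exact: (sum_iter_opT_W (size p) (fun k => p`_k)).
Qed.

(** Both limits in the definition of Q_sigma are instances of this fact, which
    at once gives existence of the limit and its independence of the
    approximating sequence: uniform convergence on the support of sigma becomes
    L2 convergence of the images under the isometry W. *)
Lemma L2cvg_W (F phi_ : nat -> R -> R[i]) (phi G : R -> R[i]) :
  (forall n, L2 (leb R) (F n)) -> (forall n, L2 sigma (phi_ n)) ->
  (forall n, F n = W (phi_ n) %[ae leb R]) -> L2 sigma phi ->
  unif_cvg_on `[- 2^-1, 2^-1] phi_ phi -> L2 (leb R) G ->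
  L2cvg (leb R) F G <-> G = W phi %[ae leb R].
Proof.
move=> F2 phi_2 FW phi2 cphi G2.
have dist n : sqnorm (leb R) (fun x => F n x - W phi x) =
    sqnorm sigma (fun u => phi_ n u - phi u).
  rewrite -W_isometry//.
  apply: sqnorm_ae; [exact: L2B (F2 n) (W_L2 phi2)|exact: L2B (W_L2 (phi_2 n)) (W_L2 phi2)|].
  by apply: aeS (FW n) => x /[apply] ->.
have cvg0 (e : R) : 0 < e ->
    \forall n \near \oo, sqnorm (leb R) (fun x => F n x - W phi x) < e.
  move=> e0; have d0 : 0 < Num.sqrt (e / 4) by rewrite sqrtr_gt0 divr_gt0.
  (* The squared norm counts the bound e / 4 on squares twice, once for each of
     the real and imaginary parts. *)
  apply: filterS (cphi _ d0) => n h; rewrite dist.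
  have := @sqnorm_bounded (fun u => phi_ n u - phi u) (Num.sqrt (e / 4)) (L2B (phi_2 n) phi2).
  rewrite sqr_sqrtr; last by rewrite divr_ge0// ltW.
  move=> /(_ (fun u Du => Re_Im_le_norm (h u Du))).
  by move=> /le_lt_trans; apply; lra.
split=> [/L2cvgP FG|GW].
- have d2 := L2B G2 (W_L2 phi2).
  suff s0 : sqnorm (leb R) (fun x => G x - W phi x) = 0.
    apply: aeS (sqnorm_eq0 d2 s0) => x /[apply] /= /eqP.
    by rewrite subr_eq0 => /eqP.
  apply/eqP; rewrite eq_le sqnorm_ge0 andbT; apply/ler_addgt0Pl => e e0.
  have e4 : 0 < e / 4 by rewrite divr_gt0.
  have [n [h1 h3]] : exists n, sqnorm (leb R) (fun x => F n x - G x) < e / 4 /\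
      sqnorm (leb R) (fun x => F n x - W phi x) < e / 4.
    have [[N1 _ h1] [N3 _ h3]] := (FG _ e4, cvg0 _ e4).
    exists (maxn N1 N3); split; [apply: h1|apply: h3] => /=.
      exact: leq_maxl.
    exact: leq_maxr.
  have -> : (fun x => G x - W phi x) = (fun x => (G x - F n x) + (F n x - W phi x)).
    by apply/funext => x; rewrite addrA subrK.
  apply: le_trans (sqnormD_le (L2B G2 (F2 n)) (L2B (F2 n) (W_L2 phi2))) _.
  have -> : sqnorm (leb R) (fun x => G x - F n x) = sqnorm (leb R) (fun x => F n x - G x).
    rewrite !sqnormE; apply: eq_Rintegral => x _.
    by rewrite !ReB !ImB -(sqrrN (Re (F n x) - _)) -(sqrrN (Im (F n x) - _)) !opprB.
  by lra.
- apply/L2cvgP => e /cvg0; apply: filterS => n; apply: le_lt_trans.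
  rewrite le_eqVlt; apply/orP; left; apply/eqP; apply: sqnorm_ae.
  + exact: L2B.
  + exact: L2B (F2 n) (W_L2 phi2).
  + by apply: aeS GW => x /[apply] ->.
Qed.

(** The functional calculus picks some limit; all of them agree with W phi,
    which is one of them as soon as polynomials approximate phi. *)
Lemma fun_calc_W (phi : R -> R[i]) : L2 sigma phi ->
  (exists p : nat -> {poly R[i]},
    unif_cvg_on `[- 2^-1, 2^-1] (fun n u => (p n).[u%:C%C]) phi) ->
  L2 (leb R) (fun_calc (leb R) (- 2^-1) 2^-1 phi T h0) /\
  fun_calc (leb R) (- 2^-1) 2^-1 phi T h0 = W phi %[ae leb R].
Proof.
move=> phi2 [p pphi]; rewrite /fun_calc; set A := (X in xget _ X).
have lim q G : unif_cvg_on `[- 2^-1, 2^-1] (fun n u => (q n).[u%:C%C]) phi ->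
    L2 (leb R) G ->
    L2cvg (leb R) (fun n => poly_op (q n) T h0) G <-> G = W phi %[ae leb R].
  move=> qphi G2; apply: L2cvg_W qphi G2 => // n; by have [] := poly_op_W (q n).
have : A (xget (fun=> 0) A).
  apply: xgetPex; exists (W phi); split; first exact: W_L2.
  by exists p; split => //; apply/lim => //; [exact: W_L2|exact: aeW].
by move=> [G2 [q [qphi /(lim _ _ qphi G2)]]].
Qed.

End functional_calculus.

(** * Uniform polynomial approximation of Lipschitz functions *)

(** Separate bounds on the two parts let real approximation be applied to each. *)
Definition Clipschitz (R : realType) (phi : R -> R[i]) (L : R) :=
  (forall u v, `|Re (phi u) - Re (phi v)| <= L * `|u - v|) /\
  (forall u v, `|Im (phi u) - Im (phi v)| <= L * `|u - v|).

Lemma lipschitz_ge0 (R : realType) (f : R -> R) (L : R) :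
  (forall u v, `|f u - f v| <= L * `|u - v|) -> 0 <= L.
Proof.
by move=> fL; have := le_trans (normr_ge0 _) (fL 1 0); rewrite subr0 normr1 mulr1.
Qed.

Lemma measurable_lipschitz (R : realType) (f : R -> R) (L : R) :
  (forall u v, `|f u - f v| <= L * `|u - v|) ->
  measurable_fun [set: measurableTypeR R] f.
Proof.
move=> fL; apply: continuous_measurable_fun => x.
have L0 := lipschitz_ge0 fL.
have L1 : 0 < L + 1 by rewrite ltr_wpDl.
apply/cvgrPdist_le => e e0; near=> y.
apply: le_trans (fL _ _) _; rewrite mulrC.
apply: (@le_trans _ _ (`|x - y| * (L + 1))); first by rewrite ler_wpM2l// lerDl.
rewrite -ler_pdivlMr//; near: y.
have /cvgrPdist_le : (fun z : R => z) z @[z --> x] --> x by exact: cvg_id.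
by move=> /(_ (e / (L + 1)) (divr_gt0 e0 L1)).
Unshelve. all: by end_near. Qed.

(** The Bernstein polynomial, that is the sum of g k * 'C(n, k) X^k (1 - X)^(n - k)
    over k <= n, in a recursive form: it is the mean of g over the number of
    successes in n tosses of a coin of bias X, and the recursion conditions on
    one toss.  The moments then need no identity on binomial coefficients. *)
Fixpoint bernstein (R : realType) (n : nat) (g : nat -> R) : {poly R} :=
  if n is m.+1 then 'X * bernstein m (g \o succn) + (1 - 'X) * bernstein m g
  else (g 0%N)%:P.

Section bernstein_theory.
Context (R : realType).
Implicit Types (g h : nat -> R) (y : R).

Lemma bernsteinS n g y : (bernstein n.+1 g).[y] =
  y * (bernstein n (g \o succn)).[y] + (1 - y) * (bernstein n g).[y].
Proof. by rewrite /= !hornerE. Qed.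

Lemma bernstein_lin n (a : R) g h y :
  (bernstein n (fun k => a * g k + h k)).[y] =
  a * (bernstein n g).[y] + (bernstein n h).[y].
Proof.
elim: n g h => [|n IH] g h; first by rewrite /= !hornerE.
rewrite !bernsteinS IH (_ : _ \o _ = fun k => a * (g \o succn) k + (h \o succn) k)//.
by rewrite IH; ring.
Qed.

Lemma bernstein_cst n (c y : R) : (bernstein n (fun=> c)).[y] = c.
Proof.
elim: n => [|n IH]; first by rewrite /= hornerE.
by rewrite bernsteinS (_ : _ \o _ = fun=> c)// IH; ring.
Qed.

Lemma bernstein_le n g h y : 0 <= y <= 1 -> (forall k, g k <= h k) ->
  (bernstein n g).[y] <= (bernstein n h).[y].
Proof.
move=> /andP[y0 y1]; elim: n g h => [|n IH] g h gh; first by rewrite /= !hornerE.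
rewrite !bernsteinS lerD// ler_wpM2l ?subr_ge0//; apply: IH => // k.
exact: gh.
Qed.

(** In the induction the first moment enters with the coefficient
    y (1 - y) - (1 - y) y = 0, so that each toss contributes y (1 - y). *)
Lemma bernstein_variance n y :
  (bernstein n (fun k => (k%:R - n%:R * y) ^+ 2)).[y] = n%:R * y * (1 - y).
Proof.
elim: n => [|n IH]; first by rewrite /= !hornerE; ring.
pose v (k : nat) : R := (k%:R - n%:R * y) ^+ 2.
pose d (k : nat) : R := k%:R - n%:R * y.
have shift (c : R) (f : nat -> R) : (forall k, f k = (d k + c) ^+ 2) ->
    (bernstein n f).[y] = n%:R * y * (1 - y) + 2 * c * (bernstein n d).[y] + c ^+ 2.
  move=> fE; have -> : f = fun k => 1 * v k + (2 * c * d k + c ^+ 2).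
    by apply/funext => k; rewrite fE /v /d; ring.
  rewrite bernstein_lin (bernstein_lin n (2 * c) d (fun=> c ^+ 2)).
  by rewrite bernstein_cst IH; ring.
rewrite bernsteinS (shift (1 - y)); last first.
  by move=> k; rewrite /d /comp; ring.
rewrite (shift (- y) (fun k => (k%:R - n.+1%:R * y) ^+ 2)); last by move=> k; rewrite /d; ring.
by ring.
Qed.

(** Bernstein's proof: |f(k/n) - f(y)| <= L |k/n - y| is at most
    L (d/2 + (k/n - y)^2 / (2 d)), and the mean of (k/n - y)^2 is
    y (1 - y) / n <= 1 / n, so n >= 1 / d^2 makes the error at most L d.  With
    K = L + 1 > 0 in place of L, the choice d = e / K gives the error e. *)
Lemma lipschitz_approx_unit (f : R -> R) (L e : R) : 0 < e ->
  (forall x y, `|f x - f y| <= L * `|x - y|) ->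
  exists p : {poly R}, forall y, 0 <= y <= 1 -> `|p.[y] - f y| <= e.
Proof.
move=> e0 fL.
have L0 := lipschitz_ge0 fL.
pose K := L + 1; pose d := e / K.
have K0 : 0 < K by rewrite ltr_wpDl.
have d0 : 0 < d by rewrite divr_gt0.
have dK : K * d = e by rewrite /d mulrC divfK// gt_eqF.
pose n := (Num.trunc (d ^- 2)).+1.
have n0 : (0 : R) < n%:R by rewrite ltr0n.
have nd : 1 <= n%:R * d ^+ 2.
  by rewrite -ler_pdivrMr ?exprn_gt0// div1r ltW// truncnS_gt// invr_ge0 exprn_ge0// ltW.
exists (bernstein n (fun k => f (k%:R / n%:R))) => y y01.
pose A := K / (2 * d * n%:R ^+ 2).
have A_gt0 : 0 < A.
  by apply: divr_gt0 => //; apply: mulr_gt0; [exact: mulr_gt0|exact: exprn_gt0].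
have close k : `|f (k%:R / n%:R) - f y| <= A * (k%:R - n%:R * y) ^+ 2 + K * d / 2.
  apply: le_trans (fL _ _) _.
  set a := k%:R / n%:R - y.
  have -> : k%:R - n%:R * y = n%:R * a.
    by rewrite /a mulrBr mulrCA divff ?mulr1// gt_eqF.
  have -> : A * (n%:R * a) ^+ 2 = K * `|a| ^+ 2 / (2 * d).
    by rewrite /A real_normK ?num_real//; field; rewrite !gt_eqF.
  apply: (@le_trans _ _ (K * `|a|)); first by rewrite ler_wpM2r// lerDl.
  rewrite -mulrA -[K * d / 2]mulrA -mulrDr ler_pM2l//.
  rewrite -subr_ge0.
  (* |a| <= d/2 + |a|^2 / (2 d), by completing the square *)
  have -> : `|a| ^+ 2 / (2 * d) + d / 2 - `|a| = (`|a| - d) ^+ 2 / (2 * d).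
    by field; rewrite gt_eqF.
  by rewrite divr_ge0 ?sqr_ge0// mulr_ge0// ltW.
have total : A * (n%:R * y * (1 - y)) + K * d / 2 <= e.
  have yy : y * (1 - y) <= 1 by move: y01 => /andP[]; nra.
  have : A * (n%:R * y * (1 - y)) <= K * d / 2.
    have -> : A * (n%:R * y * (1 - y)) = K * d / 2 * (y * (1 - y) / (n%:R * d ^+ 2)).
      by rewrite /A; field; rewrite !gt_eqF.
    apply: ler_piMr; first by rewrite ltW// divr_gt0// mulr_gt0.
    rewrite ler_pdivrMr ?mul1r; last by rewrite mulr_gt0 ?exprn_gt0.
    exact: le_trans yy nd.
  by move: dK; lra.
(* With c = A and c = - A this is the value of the Bernstein polynomial of the
   parabolas that bound k |-> f(k/n) from above and from below. *)
have sign (c : R) : (bernstein n (fun k => c * (k%:R - n%:R * y) ^+ 2 +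
      (f y + c / A * (K * d / 2)))).[y] =
    c * (n%:R * y * (1 - y)) + (f y + c / A * (K * d / 2)).
  by rewrite bernstein_lin bernstein_cst bernstein_variance.
have AA : A / A = 1 by rewrite divff ?gt_eqF.
have NAA : - A / A = - 1 by rewrite mulNr AA.
have lo := @bernstein_le n (fun k => - A * (k%:R - n%:R * y) ^+ 2 +
  (f y + - A / A * (K * d / 2))) (fun k => f (k%:R / n%:R)) y y01.
have up := @bernstein_le n (fun k => f (k%:R / n%:R))
  (fun k => A * (k%:R - n%:R * y) ^+ 2 + (f y + A / A * (K * d / 2))) y y01.
rewrite sign NAA in lo; rewrite sign AA in up.
rewrite ler_norml; apply/andP; split.
- have /lo : forall k, - A * (k%:R - n%:R * y) ^+ 2 + (f y + -1 * (K * d / 2)) <=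
      f (k%:R / n%:R).
    by move=> k; have := close k; rewrite ler_norml => /andP[+ _]; lra.
  by move: total; lra.
- have /up : forall k, f (k%:R / n%:R) <=
      A * (k%:R - n%:R * y) ^+ 2 + (f y + 1 * (K * d / 2)).
    by move=> k; have := close k; rewrite ler_norml => /andP[_]; lra.
  by move: total; lra.
Qed.

Lemma lipschitz_approx (f : R -> R) (L e : R) : 0 < e ->
  (forall x y, `|f x - f y| <= L * `|x - y|) ->
  exists p : {poly R}, forall u, `[- 2^-1, 2^-1]%classic u -> `|p.[u] - f u| <= e.
Proof.
move=> e0 fL.
have [|p pf] := @lipschitz_approx_unit (fun y => f (y - 2^-1)) L e e0.
  by move=> x y; apply: le_trans (fL _ _) _; rewrite opprB addrA subrK.
exists (p \Po ('X + (2^-1)%:P)) => u; rewrite /= in_itv /= => /andP[u1 u2].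
rewrite horner_comp !hornerE; have := pf (u + 2^-1); rewrite addrK; apply.
by apply/andP; split; lra.
Qed.

(** The real and imaginary parts are approximated separately, with error
    1 / (n + 1) each. *)
Lemma lipschitz_unif_cvg (phi : R -> R[i]) (L : R) :
  Clipschitz phi L ->
  exists p : nat -> {poly R[i]},
    unif_cvg_on `[- 2^-1, 2^-1] (fun n u => (p n).[u%:C%C]) phi.
Proof.
move=> [LR LI].
have /choice[p pP] : forall n : nat, exists p : {poly R[i]}, forall u,
    `[- 2^-1, 2^-1]%classic u -> Re `|p.[u%:C%C] - phi u| <= 2 * n.+1%:R^-1.
  move=> n; have e0 : (0 : R) < n.+1%:R^-1 by rewrite invr_gt0.
  have [p pR] := lipschitz_approx e0 LR.
  have [q qI] := lipschitz_approx e0 LI.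
  exists (map_poly (real_complex R) p + ('i%C)%:P * map_poly (real_complex R) q).
  move=> u Du; set z := _ - phi u.
  have -> : z = ((p.[u] - Re (phi u)) +i* (q.[u] - Im (phi u)))%C.
    rewrite /z !hornerE !horner_map /=.
    apply/eqP; rewrite eq_complex; apply/andP; split; apply/eqP.
      by rewrite ReB ReD ReM /=; ring.
    by rewrite ImB ImD ImM /=; ring.
  apply: le_trans (complex_norm_le _) _ => /=.
  by rewrite mulr2n mulrDl mul1r lerD//; [exact: pR|exact: qI].
exists p => e e0; near=> n => u Du; apply: le_lt_trans (pP n u Du) _.
rewrite ltr_pdivrMr// mulrC -ltr_pdivrMr//.
apply: (@lt_trans _ _ n%:R); last by rewrite ltr_nat.
by near: n; exact: nbhs_infty_gtr.
Unshelve. all: by end_near. Qed.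

End bernstein_theory.

(** * Fourier transforms of integrable functions *)

(** The mean value theorem. *)
Lemma lipschitz1_derive (R : realType) (f df : R -> R) :
  (forall x : R, is_derive x 1 f (df x)) -> (forall x, `|df x| <= 1) ->
  forall x y, `|f x - f y| <= `|x - y|.
Proof.
move=> fdf df1.
have cf : continuous f.
  by move=> x; apply/differentiable_continuous/derivable1_diffP; have [] := fdf x.
suff le_ x y : x <= y -> `|f y - f x| <= `|y - x|.
  move=> x y; have [xy|/ltW yx] := leP x y; last exact: le_.
  by rewrite distrC (distrC x); exact: le_.
move=> xy; have [|c _ ->] := @MVT_segment R f df x y xy (fun z _ => fdf z).
  exact: continuous_subspaceT.
by rewrite normrM ler_piMl.
Qed.

Lemma cos_lipschitz (R : realType) (x y : R) : `|cos x - cos y| <= `|x - y|.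
Proof.
apply: (@lipschitz1_derive R cos (fun x => - sin x)) => z.
by rewrite normrN sin_max.
Qed.

Lemma sin_lipschitz (R : realType) (x y : R) : `|sin x - sin y| <= `|x - y|.
Proof. by apply: (@lipschitz1_derive R sin cos) => z; exact: cos_max. Qed.

Section fourier_theory.
Context (R : realType).
Implicit Types (a b h : R -> R) (psi chi : R -> R[i]) (u v : R).

Local Notation Rintegrable f := ((leb R).-integrable setT (EFin \o f)).

Definition Cintegrable psi :=
  Rintegrable (fun x => Re (psi x)) /\ Rintegrable (fun x => Im (psi x)).

Lemma le_norm_Rintegral a b : Rintegrable a -> Rintegrable b ->
  (forall x, `|a x| <= b x) ->
  `|\int[leb R]_x a x| <= \int[leb R]_x b x.
Proof.
move=> ia ib ab; apply: le_trans (le_normr_Rintegral measurableT ia) _.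
apply: le_Rintegral => //; exact: integrable_norm.
Qed.

Lemma integrable_bounded_mul h a :
  measurable_fun [set: measurableTypeR R] h -> (forall x, `|h x| <= 1) ->
  Rintegrable a -> Rintegrable (fun x => h x * a x).
Proof.
move=> mh h1 ia; apply: (le_integrable measurableT) (ia).
  apply/measurable_EFinP; apply: measurable_funM => //.
  by have /measurable_EFinP := measurable_int _ ia.
by move=> x _; rewrite lee_fin normrM ler_piMl.
Qed.

Lemma measurable_cosM u : measurable_fun [set: measurableTypeR R] (fun x : R => cos (u * x)).
Proof.
apply: continuous_measurable_fun => x; apply: continuous_comp; last exact: continuous_cos.
exact: mulrl_continuous.
Qed.

Lemma measurable_sinM u : measurable_fun [set: measurableTypeR R] (fun x : R => sin (u * x)).
Proof.
apply: continuous_measurable_fun => x; apply: continuous_comp; last exact: continuous_sin.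
exact: mulrl_continuous.
Qed.

Lemma integrable_cosM u a : Rintegrable a -> Rintegrable (fun x => cos (u * x) * a x).
Proof. by apply: integrable_bounded_mul => [|x]; [exact: measurable_cosM|exact: cos_max]. Qed.

Lemma integrable_sinM u a : Rintegrable a -> Rintegrable (fun x => sin (u * x) * a x).
Proof. by apply: integrable_bounded_mul => [|x]; [exact: measurable_sinM|exact: sin_max]. Qed.

Lemma Re_fourier psi u : Re (fourier psi u) =
  \int[leb R]_x (cos (u * x) * Re (psi x) - sin (u * x) * Im (psi x)).
Proof. by apply: eq_Rintegral => x _; rewrite ReM. Qed.

Lemma Im_fourier psi u : Im (fourier psi u) =
  \int[leb R]_x (cos (u * x) * Im (psi x) + sin (u * x) * Re (psi x)).
Proof. by apply: eq_Rintegral => x _; rewrite ImM. Qed.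

Lemma Rintegrable_norm a : Rintegrable a -> Rintegrable (fun x => `|a x|).
Proof. exact: integrable_norm. Qed.

(** L1 convergence implies uniform convergence of the Fourier transforms.  The
    factor 2 comes from bounding real and imaginary parts separately. *)
Lemma fourier_dist psi chi u : Cintegrable psi -> Cintegrable chi ->
  Re `|fourier psi u - fourier chi u| <=
  2 * \int[leb R]_x (`|Re (psi x) - Re (chi x)| + `|Im (psi x) - Im (chi x)|).
Proof.
move=> [pr pi] [cr ci]; apply: le_trans (complex_norm_le _) _.
rewrite ReB ImB !Re_fourier !Im_fourier mulr2n mulrDl mul1r.
have iN := Rintegrable_norm; have iC := integrable_cosM; have iS := integrable_sinM.
have iB := integrable_subR; have iD := integrable_addR.
have tri (p q s t : R) : `|p| <= 1 -> `|q| <= 1 -> `|p * s + q * t| <= `|s| + `|t|.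
  move=> p1 q1; apply: le_trans (ler_normD _ _) _; rewrite !normrM.
  by apply: lerD; rewrite ler_piMl.
rewrite -!RintegralB//; first apply: lerD.
- apply: le_norm_Rintegral.
  + by apply: (iB); apply: (iB); first [exact: iC|exact: iS].
  + by apply: iD; apply: iN; exact: iB.
  + move=> x; have -> : forall p q s t s' t' : R, p * s - q * t - (p * s' - q * t') =
      p * (s - s') + - q * (t - t') by move=> *; ring.
    by apply: tri; rewrite ?normrN ?cos_max ?sin_max.
- apply: le_norm_Rintegral.
  + by apply: iB; apply: iD; first [exact: iC|exact: iS].
  + by apply: iD; apply: iN; exact: iB.
  + move=> x; have -> : forall p q s t s' t' : R, p * t + q * s - (p * t' + q * s') =
      q * (s - s') + p * (t - t') by move=> *; ring.
    by apply: tri; rewrite ?normrN ?cos_max ?sin_max.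
- by apply: iD; [exact: iC|exact: iS].
- by apply: iD; [exact: iC|exact: iS].
- by apply: iB; [exact: iC|exact: iS].
- by apply: iB; [exact: iC|exact: iS].
Qed.

(** cos and sin being 1-Lipschitz, |cos(ux) - cos(vx)| <= |u - v| |x|, and the
    factor |x| is absorbed by the first moment of psi. *)
Lemma fourier_lipschitz psi : Cintegrable psi ->
  Rintegrable (fun x => x * Re (psi x)) -> Rintegrable (fun x => x * Im (psi x)) ->
  exists L, Clipschitz (fourier psi) L.
Proof.
move=> [pr pi] xr xi.
have iN := Rintegrable_norm; have iC := integrable_cosM; have iS := integrable_sinM.
have iB := integrable_subR; have iD := integrable_addR.
have iM := integrable_mulR.
pose g (x : R) : R := `|x * Re (psi x)| + `|x * Im (psi x)|.
have ig : Rintegrable g by apply: iD; exact: iN.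
have lip (p : R -> R) (u v x c : R) : (forall y z, `|p y - p z| <= `|y - z|) ->
    `|(p (u * x) - p (v * x)) * c| <= `|u - v| * `|x * c|.
  move=> hp; rewrite (normrM _ c) (normrM x c) mulrA -(normrM (u - v)) mulrBl.
  exact: ler_wpM2r.
exists (\int[leb R]_x g x); split => u v.
- rewrite !Re_fourier -RintegralB//; last 2 first.
  + by apply: iB; [exact: iC|exact: iS].
  + by apply: iB; [exact: iC|exact: iS].
  rewrite mulrC -RintegralZl//; apply: le_norm_Rintegral.
  + by apply: (iB); apply: (iB); first [exact: iC|exact: iS].
  + exact: iM.
  move=> x; have -> : forall p q s t p' q' : R, p * s - q * t - (p' * s - q' * t) =
    (p - p') * s - (q - q') * t by move=> *; ring.
  rewrite mulrDr; apply: le_trans (ler_normB _ _) _; apply: lerD.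
    by apply: lip => //; exact: cos_lipschitz.
  by apply: lip => //; exact: sin_lipschitz.
- rewrite !Im_fourier -RintegralB//; last 2 first.
  + by apply: iD; [exact: iC|exact: iS].
  + by apply: iD; [exact: iC|exact: iS].
  rewrite mulrC -RintegralZl//; apply: le_norm_Rintegral.
  + by apply: iB; apply: iD; first [exact: iC|exact: iS].
  + exact: iM.
  move=> x; have -> : forall p q s t p' q' : R, p * t + q * s - (p' * t + q' * s) =
    (q - q') * s + (p - p') * t by move=> *; ring.
  rewrite mulrDr; apply: le_trans (ler_normD _ _) _; apply: lerD.
    by apply: lip => //; exact: sin_lipschitz.
  by apply: lip => //; exact: cos_lipschitz.
Qed.

Lemma integrable_oneDsqrV : Rintegrable (fun x => (oneDsqr x)^-1).
Proof.
have mV : measurable_fun [set: measurableTypeR R] (fun x : R => (oneDsqr x)^-1).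
  by apply: continuous_measurable_fun; exact: continuous_oneDsqrV.
have V0 (x : R) : 0 <= (oneDsqr x)^-1 by rewrite invr_ge0 ltW// oneDsqr_gt0.
apply/integrableP; split; first exact/measurable_EFinP.
under eq_integral do rewrite gee0_abs ?lee_fin//.
rewrite /leb ge0_symfun_integralT//.
- have -> : [set x : R | 0 <= x] = `[0, +oo[%classic by rewrite set_itvcy.
  by rewrite integral0y_oneDsqr -EFinM ltry.
- exact: continuous_oneDsqrV.
- by move=> x /=; rewrite /oneDsqr sqrrN.
Qed.

(** The weight 1 / (1 + x^2) has integral pi. *)
Lemma integrable_decay a (M : R) : measurable_fun [set: measurableTypeR R] a ->
  (forall x, `|a x| * oneDsqr x <= M) -> Rintegrable a.
Proof.
move=> ma aM; apply: (le_integrable measurableT) (integrable_mulR M integrable_oneDsqrV).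
  exact/measurable_EFinP.
move=> x _; rewrite lee_fin; apply: le_trans (ler_norm _).
by rewrite ler_pdivlMr ?oneDsqr_gt0.
Qed.

Lemma schwartzR_measurable a : schwartzR a -> measurable_fun [set: measurableTypeR R] a.
Proof.
move=> [da _]; apply: continuous_measurable_fun => x.
by apply/differentiable_continuous/derivable1_diffP; exact: (da 0%N).
Qed.

(** The decay of x^k a(x) comes from the two seminorms of orders k and k + 2. *)
Lemma schwartzR_integrable a k : schwartzR a -> Rintegrable (fun x => x ^+ k * a x).
Proof.
move=> sa; have [_ dec] := sa; have [M1 h1] := dec k 0%N; have [M2 h2] := dec k.+2 0%N.
apply: (@integrable_decay _ (M1 + M2)).
  apply: measurable_funM; last exact: schwartzR_measurable.
  exact: exprn_measurable.
move=> x; have {}h1 := h1 x; have {}h2 := h2 x; rewrite derive1n0 in h1 h2.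
rewrite /oneDsqr mulrDr mulr1 lerD//; apply: le_trans h2.
have -> : x ^+ k.+2 * a x = x ^+ k * a x * x ^+ 2.
  by rewrite -[k.+2]addn2 exprD mulrAC.
by rewrite (normrM (x ^+ k * a x) (x ^+ 2)) (ger0_norm (sqr_ge0 x)).
Qed.

Lemma schwartzR0 : @schwartzR R (fun=> 0).
Proof.
have d0 n : derive1n n (fun _ : R => 0 : R) = (fun=> 0).
  elim: n => // n IH; rewrite derive1nS IH; apply/funext => x.
  exact: derive1_cst.
split=> [n x|k m]; first by rewrite d0; exact: derivable_cst.
by exists 0 => x; rewrite d0 mulr0 normr0.
Qed.

Lemma schwartz_integrable psi : schwartz psi -> Cintegrable psi.
Proof.
move=> [sr si]; split.
- by have := schwartzR_integrable 0 sr; under eq_fun do rewrite expr0 mul1r.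
- by have := schwartzR_integrable 0 si; under eq_fun do rewrite expr0 mul1r.
Qed.

Lemma schwartz_fourier_lipschitz psi : schwartz psi ->
  exists L, Clipschitz (fourier psi) L.
Proof.
move=> s; have [sr si] := s; apply: fourier_lipschitz (schwartz_integrable s) _ _.
- exact: (schwartzR_integrable 1 sr).
- exact: (schwartzR_integrable 1 si).
Qed.

End fourier_theory.

(** * Smooth approximations of the oriented indicator *)

Section smooth_step.
Context (R : realType).
Implicit Types (c t x y : R) (p : {poly R}).

Definition logistic x : R := (1 + expR (- x))^-1.

Lemma logistic_denom_gt0 x : 0 < 1 + expR (- x).
Proof. by rewrite addr_gt0 ?expR_gt0. Qed.

Lemma logistic_itv x : 0 <= logistic x <= 1.
Proof.
rewrite invr_ge0 ltW ?logistic_denom_gt0//= invf_le1 ?logistic_denom_gt0//.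
by rewrite lerDl expR_ge0.
Qed.

Lemma is_derive_logistic x :
  is_derive x 1 logistic (logistic x * (1 - logistic x)).
Proof.
have de : is_derive x 1 (fun y => expR (- y)) (- expR (- x)).
  have := is_derive1_comp (is_derive_expR (- x)) (is_deriveNid x 1).
  by rewrite mulrN1.
have d1 : is_derive x 1 (fun y => 1 + expR (- y)) (- expR (- x)).
  have := is_deriveD (is_derive_cst (1 : R) x 1) de.
  by rewrite add0r.
have n0 : 1 + expR (- x) != 0 by rewrite gt_eqF// logistic_denom_gt0.
have := @is_deriveV R (fun y => 1 + expR (- y)) x _ 1 n0 d1; rewrite /logistic.
congr is_derive.
by rewrite /GRing.scale /=; field.
Qed.

Lemma is_derive_poly_logistic p c t x :
  is_derive x 1 (fun y => p.[logistic (c * (y - t))])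
    (c *: (p^`() * ('X * (1 - 'X)))).[logistic (c * (x - t))].
Proof.
have da : is_derive x 1 (fun y => c * (y - t)) c.
  have := is_deriveZ c (is_deriveB (is_derive_id x 1) (is_derive_cst t x 1)).
  by rewrite subr0 [_ *: _]mulr1.
have dl := @is_derive1_comp R logistic (fun y => c * (y - t)) x _ _
  (is_derive_logistic (c * (x - t))) da.
have := @is_derive1_comp R (horner p) (logistic \o (fun y => c * (y - t))) x _ _
  (is_derive_poly p _) dl.
by congr is_derive; rewrite !hornerE /=; ring.
Qed.

(** As S' = S (1 - S) for the logistic function S, every derivative of S(c x) is
    a polynomial in S(c x); these are the polynomials, starting from S itself. *)
Fixpoint logistic_derive_poly c k : {poly R} :=
  if k is j.+1 then c *: ((logistic_derive_poly c j)^`() * ('X * (1 - 'X))) else 'X.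

(** A smooth version of 1_{x > 0} - 1_{x > t} when c is large. *)
Definition smooth_step c t x : R := logistic (c * x) - logistic (c * (x - t)).

Lemma smooth_step_derive1n c t k : derive1n k (smooth_step c t) =
  fun x => (logistic_derive_poly c k).[logistic (c * x)] -
           (logistic_derive_poly c k).[logistic (c * (x - t))].
Proof.
elim: k => [|k IH]; first by apply/funext => x; rewrite /= !hornerX.
rewrite derive1nS IH; apply/funext => x; rewrite derive1E.
have d0 := is_derive_poly_logistic (logistic_derive_poly c k) c 0 x.
have dt := is_derive_poly_logistic (logistic_derive_poly c k) c t x.
have := is_deriveB d0 dt; rewrite subr0.
under [X in is_derive _ _ (X - _)]eq_fun do rewrite subr0.
by move=> [_ <-].
Qed.

Lemma smooth_step_derivable c t k x : derivable (derive1n k (smooth_step c t)) x 1.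
Proof.
rewrite smooth_step_derive1n.
have d0 := is_derive_poly_logistic (logistic_derive_poly c k) c 0 x.
have dt := is_derive_poly_logistic (logistic_derive_poly c k) c t x.
have := is_deriveB d0 dt.
under [X in is_derive _ _ (X - _)]eq_fun do rewrite subr0.
by case.
Qed.

(** Boundedness has to be carried along for the induction on the polynomial. *)
Lemma poly_lipschitz_unit p : exists C, 0 <= C /\
  forall x y, 0 <= x <= 1 -> 0 <= y <= 1 ->
    `|p.[x]| <= C /\ `|p.[x] - p.[y]| <= C * `|x - y|.
Proof.
elim/poly_ind: p => [|p a [C [C0 pC]]].
  by exists 0; split=> // x y _ _; rewrite !horner0 subrr normr0 mul0r.
exists (2 * C + `|a|); split; first by rewrite addr_ge0 ?mulr_ge0.
move=> x y x01 y01; have [px pxy] := pC x y x01 y01.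
have x1 : `|x| <= 1 by rewrite ger0_norm; case/andP: x01.
have y1 : `|y| <= 1 by rewrite ger0_norm; case/andP: y01.
rewrite !hornerE; split.
  apply: le_trans (ler_normD _ _) _; rewrite lerD2r normrM.
  have : `|p.[x]| * `|x| <= C by rewrite -[C]mulr1 ler_pM.
  by lra.
have -> : p.[x] * x + a - (p.[y] * y + a) = p.[x] * (x - y) + (p.[x] - p.[y]) * y.
  by ring.
apply: le_trans (ler_normD _ _) _; rewrite !normrM mulrDl.
have h1 : `|p.[x]| * `|x - y| <= C * `|x - y| by rewrite ler_wpM2r.
have h2 : `|p.[x] - p.[y]| * `|y| <= C * `|x - y| by rewrite -[leRHS]mulr1 ler_pM.
have h3 : 0 <= `|a| * `|x - y| by rewrite mulr_ge0.
by lra.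
Qed.

Lemma logisticE x : logistic x = expR x / (1 + expR x).
Proof.
have e0 := expR_gt0 x.
by rewrite /logistic expRN; field; rewrite !gt_eqF// addr_gt0.
Qed.

(** With a = exp(-c x) and q = exp(c t), the step equals
    (q - 1) a / ((1 + a) (1 + a q)), and this fraction is at most a and also at
    most 1 / (a q). *)
Lemma smooth_step_decay c t : exists M, forall x,
  `|smooth_step c t x| <= M * expR (- `|c * x|).
Proof.
pose q := expR (c * t); have q0 : 0 < q by exact: expR_gt0.
exists (`|q - 1| * (1 + q^-1)) => x; rewrite /smooth_step.
pose a := expR (- (c * x)); have a0 : 0 < a by exact: expR_gt0.
have -> : logistic (c * (x - t)) = (1 + a * q)^-1.
  by rewrite /logistic mulrBr opprB expRD (mulrC a).
have -> : logistic (c * x) = (1 + a)^-1 by [].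
have aq0 : 0 < 1 + a * q by rewrite addr_gt0 ?mulr_gt0.
have a1 : 0 < 1 + a by rewrite addr_gt0.
have -> : (1 + a)^-1 - (1 + a * q)^-1 = (q - 1) * (a / ((1 + a) * (1 + a * q))).
  by field; rewrite !gt_eqF.
rewrite normrM -mulrA ler_wpM2l// ger0_norm; last first.
  by apply: divr_ge0; [exact: ltW|rewrite mulr_ge0 //; exact: ltW].
rewrite ler_pdivrMr ?mulr_gt0//.
have [cx|cx] := leP 0 (c * x).
  rewrite ger0_norm// -/a.
  have : a * 1 <= a * ((1 + q^-1) * ((1 + a) * (1 + a * q))).
    apply: ler_wpM2l; first exact: ltW.
    have ge1D (r : R) : 0 < r -> 1 <= 1 + r by move=> r0; rewrite lerDl ltW.
    apply: mulr_ege1; first by apply: ge1D; rewrite invr_gt0.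
    by apply: mulr_ege1; apply: ge1D => //; exact: mulr_gt0.
  by rewrite mulr1; congr (_ <= _); ring.
rewrite ltr0_norm// opprK -[expR (c * x)]invrK -expRN -/a.
have -> : (1 + q^-1) * a^-1 * ((1 + a) * (1 + a * q)) =
  a + (1 + q^-1) * a^-1 * (1 + a + a * q) + a * q.
  by field; rewrite !gt_eqF.
rewrite -addrA lerDl addr_ge0 ?mulr_ge0 ?addr_ge0 ?mulr_ge0 ?invr_ge0//; exact: ltW.
Qed.

Lemma pow_le_expR x k : 0 <= x -> x ^+ k <= k`!%:R * expR x.
Proof.
move=> x0; case: k => [|k].
  by rewrite expr0 fact0 mul1r; have := expR_ge1Dx x; lra.
rewrite mulrC -ler_pdivrMr ?ltr0n ?fact_gt0//.
by have := expR_ge1Dxn k x0; lra.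
Qed.

(** A derivative of the step is a difference of values of one polynomial at two
    points of [0, 1], hence at most a constant times the step itself, which
    decays exponentially. *)
Lemma smooth_step_schwartz c t : 0 < c -> schwartzR (smooth_step c t).
Proof.
move=> c0; split; first by move=> n x; exact: smooth_step_derivable.
move=> k m; rewrite smooth_step_derive1n.
have [C [C0 pC]] := poly_lipschitz_unit (logistic_derive_poly c m).
have [M stM] := smooth_step_decay c t.
exists (C * M * k`!%:R / c ^+ k) => x.
have [_ h] := pC _ _ (logistic_itv (c * x)) (logistic_itv (c * (x - t))).
have M0 : 0 <= M.
  by rewrite -(pmulr_lge0 _ (expR_gt0 (- `|c * x|))); exact: le_trans (normr_ge0 _) (stM x).
rewrite normrM; apply: (@le_trans _ _ (`|x ^+ k| * (C * (M * expR (- `|c * x|))))).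
  apply: ler_wpM2l => //; apply: le_trans h _; apply: ler_wpM2l => //.
  exact: stM.
have := @pow_le_expR `|c * x| k (normr_ge0 _).
rewrite ler_pdivlMr ?exprn_gt0// normrM (gtr0_norm c0) exprMn normrX => hk.
have -> : `|x| ^+ k * (C * (M * expR (- (c * `|x|)))) * c ^+ k =
    C * M * (c ^+ k * `|x| ^+ k * expR (- (c * `|x|))) by ring.
apply: ler_wpM2l; first exact: mulr_ge0.
by rewrite -ler_pdivlMr ?expR_gt0// -expRN opprK.
Qed.

Definition signed_indic t x : R :=
  if 0 <= t then \1_(`[0, t]) x else - \1_(`[t, 0]) x.

(** The boolean b is a Heaviside function at x, free to take either value at 0:
    the indicators of closed intervals need both conventions. *)
Lemma logistic_close x (b : bool) : (0 < x -> b) -> (x < 0 -> ~~ b) ->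
  `|logistic x - b%:R| <= expR (- `|x|).
Proof.
move=> bpos bneg; have e0 := expR_gt0 (- x); have d0 := logistic_denom_gt0 x.
have /andP[l0 l1] := logistic_itv x.
have [x0|x0|x0] := ltgtP 0 x.
- rewrite (bpos x0) (gtr0_norm x0) distrC ger0_norm ?subr_ge0//.
  have -> : 1%:R - logistic x = expR (- x) / (1 + expR (- x)).
    by rewrite /logistic; field; rewrite gt_eqF.
  by rewrite ler_pdivrMr// ler_peMr// ?lerDl// ltW.
- rewrite (negbTE (bneg x0)) (ltr0_norm x0) opprK subr0 ger0_norm// logisticE.
  by rewrite ler_pdivrMr ?addr_gt0 ?expR_gt0// ler_peMr ?lerDl ?expR_ge0.
- rewrite -x0 normr0 oppr0 expR0 ler_norml; rewrite -x0 in l0 l1.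
  by case: b {bpos bneg} => /=; apply/andP; split; lra.
Qed.

Lemma smooth_step_close c t x : 0 < c ->
  `|smooth_step c t x - signed_indic t x| <=
  expR (- (c * `|x|)) + expR (- (c * `|x - t|)).
Proof.
move=> c0; have [b1 [b2 [-> p1 n1 p2 n2]]] : exists b1 b2 : bool,
    [/\ signed_indic t x = b1%:R - b2%:R, 0 < x -> b1, x < 0 -> ~~ b1,
      0 < x - t -> b2 & x - t < 0 -> ~~ b2].
  rewrite /signed_indic !indicE !mem_setE !in_itv/=; case: (leP 0 t) => t0.
    exists (0 <= x), (t < x); split; [|exact: ltW|by rewrite -ltNge|by rewrite subr_gt0|].
      by case: (leP 0 x) => /= x0; case: (ltP t x) => //= tx; lra.
    by rewrite subr_lt0 -leNgt; exact: ltW.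
  exists (0 < x), (t <= x); split; [|by []|by rewrite -leNgt; exact: ltW
    |by rewrite subr_gt0; exact: ltW|by rewrite subr_lt0 -ltNge].
  by case: (ltP 0 x) => /= x0; case: (leP t x) => //= tx; lra.
have -> : smooth_step c t x - (b1%:R - b2%:R) =
    (logistic (c * x) - b1%:R) - (logistic (c * (x - t)) - b2%:R).
  by rewrite /smooth_step; ring.
rewrite -[X in X * `|x|](gtr0_norm c0) -[X in X * `|x - t|](gtr0_norm c0) -!normrM.
apply: le_trans (ler_normB _ _) _; apply: lerD; apply: logistic_close.
- by rewrite pmulr_rgt0.
- by rewrite pmulr_rlt0.
- by rewrite pmulr_rgt0.
- by rewrite pmulr_rlt0.
Qed.

End smooth_step.

(** * The Fourier transform of the oriented indicator *)

Section indicator_fourier.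
Context (R : realType).
Implicit Types (t u x : R).

Local Notation Rintegrable f := ((leb R).-integrable setT (EFin \o f)).

Lemma measurable_signed_indic t :
  measurable_fun [set: measurableTypeR R] (signed_indic t).
Proof.
rewrite /signed_indic; case: (leP 0 t) => _.
  by apply: measurable_indic; exact: measurable_itv.
by apply: measurable_funN; apply: measurable_indic; exact: measurable_itv.
Qed.

Lemma signed_indic_le t x : `|signed_indic t x| <= 1 /\
  (signed_indic t x != 0 -> `|x| <= `|t|).
Proof.
rewrite /signed_indic !indicE !mem_setE !in_itv/=; case: (leP 0 t) => t0.
  case: andP => [[x0 xt]|_]; last by rewrite normr0 eqxx.
  by rewrite normr1 !ger0_norm.
case: andP => [[xt x0]|_]; last by rewrite oppr0 normr0 eqxx.
by rewrite normrN normr1 (ler0_norm x0) (ltr0_norm t0) lerN2.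
Qed.

Lemma signed_indic_integrable t k : Rintegrable (fun x => x ^+ k * signed_indic t x).
Proof.
apply: (@integrable_decay _ _ (`|t| ^+ k * oneDsqr t)).
  by apply: measurable_funM; [exact: exprn_measurable|exact: measurable_signed_indic].
move=> x; have [i1 it] := signed_indic_le t x.
have dt : 0 <= oneDsqr t by rewrite ltW// oneDsqr_gt0.
have dx : 0 <= oneDsqr x by rewrite ltW// oneDsqr_gt0.
have [->|/it xt] := eqVneq (signed_indic t x) 0.
  by rewrite mulr0 normr0 mul0r mulr_ge0// exprn_ge0.
apply: ler_pM => //.
- rewrite normrM normrX -[`|t| ^+ k]mulr1; apply: ler_pM => //.
  by apply: lerXn2r; rewrite ?nnegrE.
- rewrite /oneDsqr lerD2l -(real_normK (num_real x)) -(real_normK (num_real t)).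
  by rewrite ler_pXn2r ?nnegrE.
Qed.

(** Compare with exp(-|x|), using |x| <= |x - t| + |t|. *)
Lemma integrable_exp_norm t : Rintegrable (fun x : R => expR (- `|x - t|)).
Proof.
apply: (@integrable_decay _ _ (3 * expR `|t|)).
  apply: continuous_measurable_fun => x.
  apply: (@continuous_comp _ _ _ (fun x => - `|x - t|) expR); last exact: continuous_expR.
  apply: cvgN; apply: cvg_norm; apply: cvgB; [exact: cvg_id|exact: cvg_cst].
move=> x; rewrite ger0_norm ?expR_ge0//.
have h : expR (- `|x - t|) <= expR `|t| * expR (- `|x|).
  rewrite -expRD ler_expR; have := ler_normD (x - t) t; rewrite subrK; lra.
have dx : 0 <= oneDsqr x by rewrite ltW// oneDsqr_gt0.
apply: le_trans (ler_wpM2r dx h) _; rewrite -mulrA [leRHS]mulrC.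
apply: ler_wpM2l; first exact: expR_ge0.
rewrite expRN mulrC ler_pdivrMr ?expR_gt0// /oneDsqr.
have := pow_le_expR 2 (normr_ge0 x); have := pow_le_expR 0 (normr_ge0 x).
by rewrite expr0 real_normK ?num_real// (_ : 2`! = 2)%N// fact0; lra.
Qed.

Lemma smooth_step_cvg t x : x != 0 -> x != t ->
  smooth_step n.+1%:R t x @[n --> \oo] --> signed_indic t x.
Proof.
move=> x0 xt.
have a0 : 0 < `|x| by rewrite normr_gt0.
have b0 : 0 < `|x - t| by rewrite normr_gt0 subr_eq0.
have small (r : R) : 0 < r -> expR (- (n.+1%:R * r)) @[n --> \oo] --> (0 : R).
  move=> r0; have -> : (fun n : nat => expR (- (n.+1%:R * r))) =
      [sequence expR (- r) ^+ n.+1]_n.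
    by apply/funext => n; rewrite -mulrN expRM_natl.
  have h : (fun n => expR (- r) ^+ n) @ \oo --> (0 : R).
    by apply: cvg_expr; rewrite ger0_norm ?expR_ge0// expR_lt1 oppr_lt0.
  by move: h; rewrite -cvg_shiftS.
apply/cvgrPdist_le => e e0.
have e20 : 0 < e / 2 by rewrite divr_gt0.
have /cvgrPdist_le/(_ _ e20) h1 := small _ a0.
have /cvgrPdist_le/(_ _ e20) h2 := small _ b0.
near=> n; rewrite distrC; apply: le_trans (smooth_step_close _ _ _) _; first by rewrite ltr0n.
have : expR (- (n.+1%:R * `|x|)) <= e / 2.
  rewrite -[leLHS]ger0_norm ?expR_ge0// -normrN -sub0r; near: n; exact: h1.
have : expR (- (n.+1%:R * `|x - t|)) <= e / 2.
  rewrite -[leLHS]ger0_norm ?expR_ge0// -normrN -sub0r; near: n; exact: h2.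
by lra.
Unshelve. all: by end_near. Qed.

(** Dominated convergence; the step and the indicator differ by at most
    exp(-n |x|) + exp(-n |x - t|), which tends to 0 off the points 0 and t. *)
Lemma smooth_step_L1 t :
  \int[leb R]_x `|smooth_step n.+1%:R t x - signed_indic t x| @[n --> \oo] --> (0 : R).
Proof.
pose g (x : R) : R := `|signed_indic t x| + (expR (- `|x - 0|) + expR (- `|x - t|)).
have ind_int : Rintegrable (signed_indic t).
  by have := signed_indic_integrable t 0; under eq_fun do rewrite expr0 mul1r.
have ig : Rintegrable g.
  apply: integrable_addR; first exact: Rintegrable_norm.
  by apply: integrable_addR; exact: integrable_exp_norm.
have [|||||] := @dominated_convergence _ _ _ (leb R) setT measurableT
  (fun n x => (smooth_step n.+1%:R t x)%:E) (EFin \o signed_indic t) (EFin \o g).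
- move=> n; apply/measurable_EFinP; apply: schwartzR_measurable.
  by apply: smooth_step_schwartz; rewrite ltr0Sn.
- by apply/measurable_EFinP; exact: measurable_signed_indic.
(* The exceptional points 0 and t form a null set. *)
- exists ([set 0] `|` [set t]); split.
  + by apply: measurableU; exact: measurable_set1.
  + by apply: null_set_setU; [exact: measurable_set1..|exact: lebesgue_measure_set1|
      exact: lebesgue_measure_set1].
  + move=> x /= /not_implyP[_ nx]; apply: contrapT => /not_orP[/eqP x0 /eqP xt].
    by apply: nx; apply: cvg_EFin; [exact: nearW|exact: smooth_step_cvg].
- exact: ig.
- apply: aeW => x n _; rewrite lee_fin /g.
  have c0 : (0 : R) < n.+1%:R by rewrite ltr0n.
  have := smooth_step_close t x c0.
  have mon (y : R) : expR (- (n.+1%:R * `|y|)) <= expR (- `|y|).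
    by rewrite ler_expR lerN2 ler_peMl// ler1n.
  have := mon x; have := mon (x - t); rewrite subr0.
  have := ler_normD (smooth_step n.+1%:R t x - signed_indic t x) (signed_indic t x).
  by rewrite subrK; lra.
move=> _ + _.
move=> /fine_cvgP[_]; apply: cvg_trans.
by apply: near_eq_cvg; near=> n.
Unshelve. all: by end_near. Qed.

(** The orientation of the indicator makes one formula valid for both signs of t. *)
Lemma signed_FTC (f F : R -> R) t : continuous f ->
  (forall x, is_derive x 1 F (f x)) ->
  \int[leb R]_x (f x * signed_indic t x) = F t - F 0.
Proof.
move=> cf dF.
have cF : continuous F.
  by move=> x; apply/differentiable_continuous/derivable1_diffP; have [] := dF x.
have ftc a b : a <= b -> \int[leb R]_(x in `[a, b]) f x = F b - F a.
  rewrite le_eqVlt => /predU1P[->|ab].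
    by rewrite set_itv1 Rintegral_set1 subrr.
  rewrite /Rintegral (@continuous_FTC2 R f F a b ab)//.
  - exact: continuous_subspaceT.
  - split; first by move=> x _; have [] := dF x.
    + exact/cvg_at_right_filter/cF.
    + exact/cvg_at_left_filter/cF.
  - by move=> x _; rewrite derive1E; have [_] := dF x.
have ind (A : set R) : \int[leb R]_x (f x * \1_A x) = \int[leb R]_(x in A) f x.
  by rewrite [RHS]Rintegral_mkcond; apply: eq_Rintegral => x _; rewrite patch_indic.
rewrite /signed_indic; case: leP => t0; first by rewrite ind ftc.
under eq_Rintegral do rewrite mulrN -mulN1r.
rewrite RintegralZl//; first by rewrite ind ftc ?(ltW t0)// mulN1r opprB.
have /continuous_compact_integrable cint : {within `[t, 0], continuous f}.
  exact: continuous_subspaceT.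
have := cint (@segment_compact _ t 0).
move=> /(iffLR (@integrable_mkcond _ _ _ (leb R) _ (EFin \o f) (measurable_itv `[t, 0]))).
congr (_.-integrable _ _).
by rewrite restrict_EFin patch_indic.
Qed.

Lemma expq0 t : expq t 0 = (0 +i* t)%C.
Proof. by rewrite /expq eqxx. Qed.

Lemma expqE t u : u != 0 ->
  expq t u = ((cos (u * t) - 1) / u +i* (sin (u * t) / u))%C.
Proof.
move=> u0; rewrite /expq (negbTE u0) -fmorphV.
by apply/eqP; rewrite eq_complex ReM ImM /= !mulr0 subr0 add0r oppr0 addr0 !eqxx.
Qed.

Lemma expqN t u : expq (- t) u = ((expq t u)^*)%C.
Proof.
have [->|u0] := eqVneq u 0; first by rewrite !expq0.
by rewrite !expqE// mulrN cosN sinN mulNr.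
Qed.

Lemma fourier_oriented_indic t u :
  fourier (oriented_indic t) u = - 'i%C * expq t u.
Proof.
have lin (x : R) : is_derive x 1 (fun x => u * x) u.
  have := is_deriveZ u (is_derive_id x 1); by rewrite [_ *: _]mulr1.
have dsin (x : R) : is_derive x 1 (fun x => sin (u * x)) (cos (u * x) * u).
  exact: (@is_derive1_comp R sin (fun x => u * x) x _ _ (is_derive_sin (u * x)) (lin x)).
have dcos (x : R) : is_derive x 1 (fun x => cos (u * x)) (- sin (u * x) * u).
  exact: (@is_derive1_comp R cos (fun x => u * x) x _ _ (is_derive_cos (u * x)) (lin x)).
have ccos : continuous (fun x => cos (u * x)).
  by move=> x; apply: continuous_comp; [exact: mulrl_continuous|exact: continuous_cos].
have csin : continuous (fun x => sin (u * x)).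
  by move=> x; apply: continuous_comp; [exact: mulrl_continuous|exact: continuous_sin].
have cst1 : continuous (fun _ : R => 1 : R) by move=> x; exact: cvg_cst.
have cst0 : continuous (fun _ : R => 0 : R) by move=> x; exact: cvg_cst.
have [->|u0] := eqVneq u 0.
  rewrite expq0; apply/eqP; rewrite eq_complex; apply/andP; split; apply/eqP.
    rewrite Re_fourier ReM /=.
    under eq_Rintegral do rewrite mulr0 subr0 mul0r cos0 -/(signed_indic _ _).
    by rewrite (signed_FTC t cst1 (fun x => is_derive_id x 1)); ring.
  rewrite Im_fourier ImM /=.
  under eq_Rintegral do rewrite mulr0 add0r mul0r sin0 -/(signed_indic _ _).
  by rewrite (signed_FTC t cst0 (fun x => is_derive_cst 0 x 1)); ring.
rewrite expqE//; apply/eqP; rewrite eq_complex; apply/andP; split; apply/eqP.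
  rewrite Re_fourier ReM /=.
  under eq_Rintegral do rewrite mulr0 subr0 -/(signed_indic _ _).
  have d (x : R) : is_derive x 1 (fun x => u^-1 * sin (u * x)) (cos (u * x)).
    have := is_deriveZ u^-1 (dsin x); congr is_derive.
    by rewrite [_ *: _]mulrC -mulrA divff// mulr1.
  by rewrite (signed_FTC t ccos d) mulr0 sin0; ring.
rewrite Im_fourier ImM /=.
under eq_Rintegral do rewrite mulr0 add0r -/(signed_indic _ _).
have d (x : R) : is_derive x 1 (fun x => - u^-1 * cos (u * x)) (sin (u * x)).
  have := is_deriveZ (- u^-1) (dcos x); congr is_derive.
  by rewrite /GRing.scale /=; field.
by rewrite (signed_FTC t csin d) mulr0 cos0; ring.
Qed.

End indicator_fourier.

(** * The isometry *)

Section Q_sigma_isometry.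
Context (R : realType) (sigma : probability (measurableTypeR R) R)
  (W : (R -> R[i]) -> R -> R[i]).
Hypothesis sigma_supp : sigma (~` `[- 2^-1, 2^-1]) = 0%E.
Hypothesis W_unitary : unitary sigma (leb R) W.
Hypothesis W1 : W (cst 1) = hermite 0 %[ae leb R].

(** A Lipschitz function is continuous, and bounded on [-1/2, 1/2]. *)
Lemma lipschitz_L2 (phi : R -> R[i]) (L : R) : Clipschitz phi L -> L2 sigma phi.
Proof.
move=> [LR LI].
have L0 := lipschitz_ge0 LR.
apply: (@L2_bounded _ _ sigma_supp _ (`|Re (phi 0)| + `|Im (phi 0)| + L)).
  by split; [exact: measurable_lipschitz LR|exact: measurable_lipschitz LI].
move=> u; rewrite /= in_itv /= => /andP[u1 u2].
have u01 : `|u - 0| <= 1 by rewrite subr0 ler_norml; apply/andP; split; lra.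
have step : L * `|u - 0| <= L by rewrite -[leRHS]mulr1 ler_wpM2l.
have hR := le_trans (LR u 0) step; have hI := le_trans (LI u 0) step.
have := ler_normD (Re (phi u) - Re (phi 0)) (Re (phi 0)).
have := ler_normD (Im (phi u) - Im (phi 0)) (Im (phi 0)).
rewrite !subrK; have := normr_ge0 (Re (phi 0)); have := normr_ge0 (Im (phi 0)).
by move=> *; split; lra.
Qed.

(** Square-integrability of the Gaussian is read off from h_0 = W(1), without
    computing its integral; measurability has to be checked on h_0 itself, as
    equality almost everywhere does not transport it. *)
Lemma L2_hermite0 : L2 (leb R) (@hermite R 0).
Proof.
have [w1 w2] : L2 (leb R) (W (cst 1)) by exact/(W_L2 W_unitary)/L2_cst.
split.
- apply: Lfun2_ae_le w1 _.
  + rewrite /hermite /hermite_poly /=.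
    apply: measurable_funM => //; apply: measurable_funM.
    * apply: measurable_funM => //.
      - apply: measurable_funM => //.
        apply: measurableT_comp; [exact: measurable_expR|exact: exprn_measurable].
      - apply: measurableT_comp; first exact: measurable_expR.
        apply: measurable_funN; exact: exprn_measurable.
    * apply: measurableT_comp; first exact: measurable_expR.
      apply: measurable_funM => //; apply: measurable_funN; exact: exprn_measurable.
  + by apply: aeS W1 => x /(_ I) ->.
- exact: Lfun2_0.
Qed.

Lemma Qschwartz_W psi : schwartz psi ->
  [/\ L2 sigma (fourier psi), L2 (leb R) (Qschwartz sigma W psi) &
  Qschwartz sigma W psi = W (fourier psi) %[ae leb R]].
Proof.
move=> /schwartz_fourier_lipschitz[L lip].
have f2 : L2 sigma (fourier psi) by exact: lipschitz_L2 lip.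
have [? ?] := fun_calc_W sigma_supp W_unitary W1 L2_hermite0 f2 (lipschitz_unif_cvg lip).
by split.
Qed.

(** One approximating sequence is required, so that the defining set of limits is
    not empty; every other sequence yields the same class by L2cvg_W. *)
Lemma Qsigma_W (g : R -> R[i]) (s_ : nat -> R -> R[i]) :
  L2 sigma (fourier g) -> (forall n, schwartz (s_ n)) ->
  unif_cvg_on setT (fun n => fourier (s_ n)) (fourier g) ->
  L2 (leb R) (Qsigma sigma W g) /\ Qsigma sigma W g = W (fourier g) %[ae leb R].
Proof.
move=> g2 ss sg; rewrite /Qsigma; set A := (X in xget _ X).
have lim (r_ : nat -> R -> R[i]) G : (forall n, schwartz (r_ n)) ->
    unif_cvg_on setT (fun n => fourier (r_ n)) (fourier g) -> L2 (leb R) G ->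
    L2cvg (leb R) (fun n => Qschwartz sigma W (r_ n)) G <->
    G = W (fourier g) %[ae leb R].
  move=> rs rg G2.
  apply: (@L2cvg_W _ _ _ sigma_supp W_unitary _ (fun n => fourier (r_ n))) => //.
  - by move=> n; have [] := Qschwartz_W (rs n).
  - by move=> n; have [] := Qschwartz_W (rs n).
  - by move=> n; have [] := Qschwartz_W (rs n).
  - by move=> e /rg; apply: filterS => n h u _; exact: h.
have : A (xget (fun=> 0) A).
  apply: xgetPex; exists (W (fourier g)); split; first exact: (W_L2 W_unitary).
  by exists s_; split => //; apply/lim => //; [exact: (W_L2 W_unitary)|exact: aeW].
by move=> [G2 [r_ [rs rg /(lim _ _ rs rg G2)]]].
Qed.

Lemma oriented_indic_approx t : exists s_ : nat -> R -> R[i],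
  (forall n, schwartz (s_ n)) /\
  unif_cvg_on setT (fun n => fourier (s_ n)) (fourier (oriented_indic t)).
Proof.
exists (fun n x => (smooth_step n.+1%:R t x)%:C%C).
have sch n : schwartz (fun x => (smooth_step n.+1%:R t x)%:C%C).
  by split; [exact: smooth_step_schwartz|exact: schwartzR0].
split=> // e e0.
have i1 : Cintegrable (oriented_indic t).
  split.
    by have := signed_indic_integrable t 0; under eq_fun do rewrite expr0 mul1r.
  exact: integrable0.
have e20 : 0 < e / 2 by rewrite divr_gt0.
have /cvgrPdist_lt/(_ _ e20) := smooth_step_L1 t.
apply: filterS => n; rewrite sub0r normrN => h u _.
apply: le_lt_trans (fourier_dist u (schwartz_integrable (sch n)) i1) _.
rewrite mulrC -ltr_pdivlMr//; apply: le_lt_trans h.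
apply: le_trans (ler_norm _).
rewrite le_eqVlt; apply/orP; left; apply/eqP; apply: eq_Rintegral => x _ /=.
by rewrite subrr normr0 addr0.
Qed.

Lemma Qsigma_indic t :
  [/\ L2 sigma (fourier (oriented_indic t)),
    L2 (leb R) (Qsigma sigma W (oriented_indic t)) &
    Qsigma sigma W (oriented_indic t) = W (fourier (oriented_indic t)) %[ae leb R]].
Proof.
have i1 : Cintegrable (oriented_indic t).
  split.
    by have := signed_indic_integrable t 0; under eq_fun do rewrite expr0 mul1r.
  exact: integrable0.
have [L lip] : exists L, Clipschitz (fourier (oriented_indic t)) L.
  apply: fourier_lipschitz i1 _ _; first exact: (signed_indic_integrable t 1).
  by under eq_fun do rewrite mulr0; exact: integrable0.
have f2 : L2 sigma (fourier (oriented_indic t)) by exact: lipschitz_L2 lip.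
have [s_ [ss sg]] := oriented_indic_approx t.
by have [] := Qsigma_W f2 ss sg.
Qed.

End Q_sigma_isometry.

Theorem theorem6p1 (R : realType) (sigma : probability (measurableTypeR R) R)
  (lam : nat -> R) (W : (R -> R[i]) -> R -> R[i])
  (sigma_supp : sigma (~` `[- 2^-1, 2^-1]) = 0%E)
  (lam0 : lam 0%N = 0) (lam_inj : injective lam)
  (lam_pi : forall n, exists k : nat, lam n = pi * k%:R)
  (onb : orthonormal_basis sigma (fun n u => expi (lam n * u)))
  (W_unitary : unitary sigma (leb R) W)
  (W_basis : forall n, W (fun u => expi (lam n * u)) = hermite n %[ae leb R])
  (t s : R) :
  inner (leb R) (Qsigma sigma W (oriented_indic t)) (Qsigma sigma W (oriented_indic s)) =
  Cintegral sigma (fun u => expq t u * expq (- s) u).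
Proof.
have W1 : W (cst 1) = hermite 0 %[ae leb R].
  have -> : cst 1 = (fun u => expi (lam 0%N * u)) :> (R -> R[i]).
    by apply/funext => u; rewrite lam0 mul0r /expi cos0 sin0.
  exact: W_basis.
have [ft2 Qt2 Qt] := Qsigma_indic sigma_supp W_unitary W1 t.
have [fs2 Qs2 Qs] := Qsigma_indic sigma_supp W_unitary W1 s.
rewrite (inner_ae Qt2 (W_L2 W_unitary ft2) Qs2 (W_L2 W_unitary fs2) Qt Qs).
rewrite (W_inner W_unitary)// /inner; congr Cintegral; apply/funext => u.
(* It remains to see (- i a) conj(- i b) = a conj(b). *)
rewrite !fourier_oriented_indic expqN.
case: (expq t u) (expq s u) => a b [c d].
by apply/eqP; rewrite eq_complex /=; apply/andP; split; apply/eqP; ring.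
Qed.
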